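(* Let $\mathrm{P}\in\mathcal{P}$ and let $(z_t)_{t\in\frac12\mathbb{Z}}$ be a $\mathrm{P}$-sequence such that the subsequence $z_0,z_1,z_2,\ldots$ (integer indices $\ge 0$) is bounded. Let $\mathbf{z}=\limsup_{k\ge0}|z_k|$ (with $k$ running over the nonnegative integers), let $\mathbf{r}>2\mathbf{z}$ and $\delta>0$, let $f$ be analytic in $\mathbb{D}_{\mathbf{r}+\delta}$, and assume $z_j\in\mathbb{D}_{\mathbf{r}+\delta}$ for all integers $j\ge0$. Then the Taylor polynomials $$\mathcal{S}_nf(x)=\sum_{k=0}^n\partial_kf(z_{k/2})\prod_{j=0}^{k-1}(x-z_j)$$ converge uniformly to $f(x)$ as $n\to\infty$ on the disk $\mathbb{D}_{\mathbf{x}}$, for any $0<\mathbf{x}<\mathbf{r}-2\mathbf{z}$.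
   Context: For $r>0$, $\mathbb{D}_r=\{z\in\mathbb{C}:|z|<r\}$. $\mathcal{P}$ denotes the set of polynomials $\mathrm{P}(x,y)=x^2+y^2-2axy-2b(x+y)+c$ with $a,b,c\in\mathbb{C}$. A $\mathrm{P}$-sequence is a sequence of complex numbers $(x_t)$ indexed by $t\in\frac12\mathbb{Z}=\{k/2:k\in\mathbb{Z}\}$ such that $\mathrm{P}(x_t,y)=(y-x_{t+\frac12})(y-x_{t-\frac12})$ (as polynomials in $y$) for all $t\in\frac12\mathbb{Z}$; $x_0$ is called its base point. For $x\in\mathbb{C}$ and any $\mathrm{P}$-sequence $(x_t)$ with base point $x_0=x$, put $\Phi_0(x,y)=1$ and $\Phi_k(x,y)=\prod_{j=0}^{k-1}(y-x_{j-\frac{k-1}{2}})$ for $k\ge1$; this does not depend on the chosen $\mathrm{P}$-sequence. For $f$ analytic in an open set $\Omega$ (here $\Omega=\mathbb{D}_{\mathbf{r}+\delta}$), define $$\partial_kf(x)=\frac{1}{2\pi i}\int_{\gamma}\frac{f(y)}{\Phi_{k+1}(x,y)}\,dy,$$ where $\gamma$ is any cycle in $\Omega$ homologous to zero with respect to $\Omega$ with winding number $1$ around each of the points $x_{j-\frac k2}$, $j=0,\ldots,k$ (which must lie in $\Omega$), $(x_t)$ being a $\mathrm{P}$-sequence with base point $x$. Thus, for a $\mathrm{P}$-sequence $(z_t)$ with $z_0,\ldots,z_k\in\Omega$, $\partial_kf(z_{k/2})=\frac{1}{2\pi i}\int_\gamma f(y)\prod_{j=0}^k(y-z_j)^{-1}\,dy$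 with $\gamma$ having winding number $1$ around $z_0,\ldots,z_k$. Empty products equal 1. *)

(* Defs.v *)
From Stdlib Require Import Reals ZArith List.
From Coquelicot Require Import Coquelicot.
Import ListNotations.

Open Scope R_scope.

Definition disk (r : R) (x : C) : Prop := Cmod x < r.

Fixpoint Cprod (F : nat -> C) (n : nat) : C :=
  match n with
  | O => 1%C
  | S m => (Cprod F m * F m)%C
  end.

(* Polynomials in two complex variables are represented by the functions they
   induce; over the infinite field C nothing is lost. *)
Definition in_calP (P : C -> C -> C) : Prop :=
  exists a b c : C, forall x y : C,
    P x y = (x * x + y * y - 2 * a * x * y - 2 * b * (x + y) + c)%C.

(* A family indexed by the half-integers is represented by [x : Z -> C], where
   [x k] stands for the term of index k/2; a shift of the index by 1/2 is thus
   a shift of [k] by 1, and the term of integer index j is [x (2 * j)]. *)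
Definition P_sequence (P : C -> C -> C) (x : Z -> C) : Prop :=
  forall (k : Z) (y : C),
    P (x k) y = ((y - x (k + 1)%Z) * (y - x (k - 1)%Z))%C.

Definition int_term (x : Z -> C) (j : nat) : C := x (2 * Z.of_nat j)%Z.

(* Product over 0 <= j < k of y - x_{j - (k-1)/2}; the half-integer
   j - (k-1)/2 is encoded by 2 j - (k-1). *)
Definition Phi (x : Z -> C) (k : nat) (y : C) : C :=
  Cprod (fun j => (y - x (2 * Z.of_nat j - (Z.of_nat k - 1))%Z)%C) k.

Definition analytic_on (Omega : C -> Prop) (f : C -> C) : Prop :=
  forall w : C, Omega w ->
    exists a : nat -> C,
      locally w (fun y : C =>
        is_pseries (K := C_AbsRing) (V := C_NormedModule) a (y - w)%C (f y)).

(* C^1 on a closed interval, up to and including the end points, is expressed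
   by the existence of a C^1 extension to the real line. *)
Definition C1_on (g : R -> C) (a b : R) : Prop :=
  exists h h' : R -> C,
    (forall t : R, is_derive (K := R_AbsRing) (V := C_R_NormedModule) h t (h' t)) /\
    (forall t : R, continuous h' t) /\
    (forall t : R, a <= t <= b -> g t = h t).

Definition piecewise_C1 (g : R -> C) : Prop :=
  exists (n : nat) (s : nat -> R),
    s O = 0 /\ s n = 1 /\
    forall i : nat, (i < n)%nat -> s i < s (S i) /\ C1_on g (s i) (s (S i)).

Record closed_path : Type := Closed_path {
  path :> R -> C;
  path_C1 : piecewise_C1 path;
  path_closed : path 0 = path 1
}.

Definition path_derive (g : R -> C) (t : R) : C :=
  (Derive (fun s => fst (g s)) t, Derive (fun s => snd (g s)) t).

(* [path_derive] may be meaningless at the finitely many break points, which do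
   not affect the integral. *)
Definition path_integral (f : C -> C) (g : closed_path) : C :=
  RInt (V := C_R_CompleteNormedModule)
    (fun t : R => (f (g t) * path_derive g t)%C) 0 1.

(* A cycle is a formal combination of closed paths with integer coefficients. *)
Definition cycle : Type := list (Z * closed_path).

Definition cycle_integral (f : C -> C) (gamma : cycle) : C :=
  fold_right
    (fun p acc => (RtoC (IZR (fst p)) * path_integral f (snd p) + acc)%C)
    (RtoC 0) gamma.

Definition in_trace (gamma : cycle) (w : C) : Prop :=
  exists p : Z * closed_path, In p gamma /\
    exists t : R, 0 <= t <= 1 /\ snd p t = w.

Definition winding (gamma : cycle) (w : C) : C :=
  (/ (2 * PI * Ci) * cycle_integral (fun y => / (y - w)) gamma)%C.

Definition homologous_to_zero (Omega : C -> Prop) (gamma : cycle) : Prop :=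
  (forall w : C, in_trace gamma w -> Omega w) /\
  (forall w : C, ~ Omega w -> winding gamma w = 0%C).

(* The node of half-integer index j - k/2 is encoded by 2 j - k. *)
Definition is_pdiff (P : C -> C -> C) (Omega : C -> Prop) (f : C -> C)
    (k : nat) (x v : C) : Prop :=
  exists (xs : Z -> C) (gamma : cycle),
    P_sequence P xs /\ xs 0%Z = x /\
    homologous_to_zero Omega gamma /\
    (forall j : nat, (j <= k)%nat ->
       let node := xs (2 * Z.of_nat j - Z.of_nat k)%Z in
       Omega node /\ ~ in_trace gamma node /\ winding gamma node = 1%C) /\
    v = (/ (2 * PI * Ci) *
         cycle_integral (fun y => f y / Phi xs (k + 1) y) gamma)%C.

(* Definite description: the value does not depend on the P-sequence with base
   point x nor on the cycle. *)
Definition pdiff (P : C -> C -> C) (Omega : C -> Prop) (f : C -> C)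
    (k : nat) (x : C) : C :=
  iota (T := C_R_CompleteNormedModule) (is_pdiff P Omega f k x).

(* z_{k/2} is [z (Z.of_nat k)]. *)
Definition taylor_poly (P : C -> C -> C) (Omega : C -> Prop) (z : Z -> C)
    (f : C -> C) (n : nat) (x : C) : C :=
  sum_n (fun k : nat =>
    (pdiff P Omega f k (z (Z.of_nat k)) *
     Cprod (fun j => x - int_term z j) k)%C) n.

(* Main.v *)
(* Idea. By Cauchy's formula [f] is a power series on the whole disk, and subtracting
   the value at a node and dividing by [y - z_j] acts on power series: a bound
   [|a_n| rho^n <= M] on the coefficients becomes [M / (rho - |z_j|)].  Peeling off the
   nodes one by one, the residue theorem identifies [pdiff k] with the divided difference
   of [f] at [z_0, ..., z_k], so that [S_n f] is the Newton interpolation polynomial and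
   the remainder at [x] is at most a constant times the product over [j <= n] of
   [(|x| + |z_j|) / (rho - |z_j|)] with [rho > r], whose factors are eventually below
   some [q < 1] because [x + 2 zbar < r]. *)

Require Import Defs.
From Stdlib Require Import Reals ZArith Lra Lia List FunctionalExtensionality.
From Coquelicot Require Import Coquelicot.

Open Scope R_scope.

(** * Complex power series *)

(** Analyticity is given locally, by an expansion around each point, whereas peeling off nodes needs
    a single series around 0 that represents [f] on the whole disk. Passing from one to the other is
    the analytic core: Cauchy's formula on a circle is obtained by shrinking the circle to a point,
    and the expansions found for different radii are glued by uniqueness of coefficients. Since
    [pdiff] is a definite description over all admissible [P]-sequences and cycles, the integral has
    to be evaluated for an arbitrary cycle: on a disk every power series has a primitive, so only
    the simple poles contribute, through their winding numbers. Two [P]-sequences with the same base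
    point differ at most by a reflection of the index, which only reverses the order of the nodes.
    Coefficient bounds are preferred to suprema on circles because division by [y - z] then loses no
    radius. One radius [rho] inside the disk lies above all nodes at once, because only finitely
    many of them exceed a given number larger than [zbar]; the margin [delta] leaves room for [rho]
    above [r]. *)

Notation is_Cseries := (is_series (K := C_AbsRing) (V := C_NormedModule)).

Lemma Cseries_unique (u : nat -> C) (l l' : C) :
  is_Cseries u l -> is_Cseries u l' -> l = l'.
Proof.
  intros H H'.
  exact (filterlim_locally_unique (V := C_NormedModule) _ _ _ H H').
Qed.

Lemma Cseries_le (u : nat -> C) (b : nat -> R) (l : C) (L : R) :
  is_Cseries u l -> is_series b L -> (forall n, Cmod (u n) <= b n) ->
  Cmod l <= L.
Proof.
  intros Hu Hb Hub.
  assert (H1 : is_lim_seq (fun n => Cmod (sum_n u n)) (Cmod l)).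
  { exact (filterlim_comp _ _ _ _ _ _ _ _ Hu (filterlim_norm (V := C_NormedModule) l)). }
  refine (is_lim_seq_le _ _ (Cmod l) L _ H1 Hb).
  intros n; induction n as [|n IH].
  - rewrite !sum_O; apply Hub.
  - rewrite !sum_Sn.
    eapply Rle_trans; [apply Cmod_triangle|].
    apply Rplus_le_compat; [exact IH|apply Hub].
Qed.

Lemma Cseries_ext (u v : nat -> C) (l l' : C) :
  (forall n, u n = v n) -> l = l' -> is_Cseries u l -> is_Cseries v l'.
Proof. intros H <-; apply is_series_ext; exact H. Qed.

Lemma Cseries_lin (c : C) (u v : nat -> C) (l m : C) :
  is_Cseries u l -> is_Cseries v m ->
  is_Cseries (fun n => u n + c * v n)%C (l + c * m)%C.
Proof.
  intros Hu Hv.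
  apply (is_series_plus (V := C_NormedModule) u (fun n => (c * v n)%C) l (c * m)%C Hu).
  exact (is_series_scal (V := C_NormedModule) c v m Hv).
Qed.

Lemma Cseries_incr (u : nat -> C) (l : C) :
  is_Cseries (fun n => u (S n)) l -> is_Cseries u (u O + l)%C.
Proof.
  intros H; apply is_series_decr_1.
  eapply Cseries_ext; [reflexivity| |exact H].
  unfold plus, opp; simpl; ring.
Qed.

Lemma is_pseries_Cseries (a : nat -> C) (y l : C) :
  is_pseries (K := C_AbsRing) (V := C_NormedModule) a y l <->
  is_Cseries (fun n => a n * y ^ n)%C l.
Proof.
  assert (E : forall n, scal (V := C_NormedModule) (pow_n (K := C_AbsRing) y n) (a n) = (a n * y ^ n)%C).
  { intros n.
    assert (E' : pow_n (K := C_AbsRing) y n = (y ^ n)%C) by (induction n; reflexivity).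
    rewrite E'; apply Cmult_comm. }
  unfold is_pseries; split; apply is_series_ext; intros n; rewrite E; reflexivity.
Qed.

(** Defined by description, so that sums are total functions of [y]; the value is meaningful
    wherever the series converges. *)
Definition psum (a : nat -> C) (y : C) : C :=
  iota (T := C_CompleteNormedModule) (is_Cseries (fun n => a n * y ^ n)%C).

Lemma psum_eq (a : nat -> C) (y l : C) :
  is_Cseries (fun n => a n * y ^ n)%C l -> psum a y = l.
Proof.
  intros H.
  apply (Cseries_unique (fun n => a n * y ^ n)%C); [|exact H].
  refine (iota_correct (V := C_CompleteNormedModule) (is_Cseries (fun n => a n * y ^ n)%C) _).
  exists l; split; [exact H|]; intros l' H'.
  exact (Cseries_unique _ _ _ H H').
Qed.

(** The shape of Cauchy's estimates. It gives convergence on the open disk of radius [rho] and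
    passes to shifts, divided differences and primitives at the same radius, with explicit
    constants. *)
Definition coef_bound (a : nat -> C) (rho M : R) : Prop :=
  forall n, Cmod (a n) * rho ^ n <= M.

Lemma coef_bound_pos a rho M : coef_bound a rho M -> 0 <= M.
Proof.
  intros H; specialize (H O); simpl in H.
  pose proof (Cmod_ge_0 (a O)); lra.
Qed.

Lemma coef_bound_weaken a rho rho' M :
  0 <= rho' <= rho -> coef_bound a rho M -> coef_bound a rho' M.
Proof.
  intros Hr H n; eapply Rle_trans; [|apply (H n)].
  apply Rmult_le_compat_l; [apply Cmod_ge_0|].
  apply pow_incr; lra.
Qed.

Lemma coef_bound_shift a rho M n :
  0 < rho -> coef_bound a rho M ->
  coef_bound (fun m => a (m + n)%nat) rho (M / rho ^ n).
Proof.
  intros Hr H m.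
  apply Rmult_le_reg_r with (rho ^ n); [now apply pow_lt|].
  replace (M / rho ^ n * rho ^ n) with M
    by (field; apply pow_nonzero; lra).
  specialize (H (m + n)%nat); rewrite pow_add in H; lra.
Qed.

Lemma coef_bound_S a rho M :
  0 < rho -> coef_bound a rho M -> coef_bound (fun n => a (S n)) rho (M / rho).
Proof.
  intros Hr H n; pose proof (coef_bound_shift a rho M 1 Hr H n) as H'.
  cbv beta in H'; rewrite Nat.add_1_r, pow_1 in H'; exact H'.
Qed.

Lemma geom_ratio_lt rho y : 0 <= y < rho -> Rabs (y / rho) < 1.
Proof.
  intros H; rewrite Rabs_pos_eq.
  - apply Rmult_lt_reg_r with rho; [lra|]; field_simplify; lra.
  - apply Rdiv_le_0_compat; lra.
Qed.

(** Comparison with the geometric series of terms [M * (|y| / rho)^n] yields both convergence and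
    the bound. *)
Lemma psum_ex (a : nat -> C) (rho M : R) (y : C) :
  coef_bound a rho M -> Cmod y < rho ->
  is_Cseries (fun n => a n * y ^ n)%C (psum a y) /\
  Cmod (psum a y) <= M * rho / (rho - Cmod y).
Proof.
  intros Ha Hy; pose proof (Cmod_ge_0 y) as Hy0.
  assert (Hr : 0 < rho) by lra.
  assert (Hg : is_series (fun n => M * (Cmod y / rho) ^ n) (M * / (1 - Cmod y / rho))).
  { apply (is_series_scal (V := R_NormedModule) M).
    apply is_series_geom, geom_ratio_lt; lra. }
  assert (Hle : forall n, Cmod (a n * y ^ n)%C <= M * (Cmod y / rho) ^ n).
  { intros n; rewrite Cmod_mult, Cmod_pow.
    replace (Cmod (a n) * Cmod y ^ n)
      with (Cmod (a n) * rho ^ n * (Cmod y / rho) ^ n).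
    - apply Rmult_le_compat_r; [|apply Ha].
      apply pow_le, Rdiv_le_0_compat; lra.
    - rewrite Rmult_assoc, <- Rpow_mult_distr; do 2 f_equal; field; lra. }
  destruct (ex_series_le (V := C_CompleteNormedModule)
              (fun n => (a n * y ^ n)%C) _ Hle) as [l Hl].
  { eexists; exact Hg. }
  rewrite (psum_eq _ _ _ Hl); split; [exact Hl|].
  replace (M * rho / (rho - Cmod y)) with (M * / (1 - Cmod y / rho))
    by (field; lra).
  exact (Cseries_le _ _ _ _ Hl Hg Hle).
Qed.

Lemma psum_correct a rho M y :
  coef_bound a rho M -> Cmod y < rho ->
  is_Cseries (fun n => a n * y ^ n)%C (psum a y).
Proof. intros; now apply (psum_ex a rho M). Qed.

Lemma psum_bound a rho M y :
  coef_bound a rho M -> Cmod y < rho ->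
  Cmod (psum a y) <= M * rho / (rho - Cmod y).
Proof. intros; now apply (psum_ex a rho M). Qed.

Lemma psum_step a rho M y :
  coef_bound a rho M -> Cmod y < rho ->
  psum a y = (a O + y * psum (fun n => a (S n)) y)%C.
Proof.
  intros Ha Hy; pose proof (Cmod_ge_0 y) as Hy0.
  pose proof (coef_bound_S a rho M ltac:(lra) Ha) as Ha'.
  apply psum_eq.
  apply (Cseries_ext (fun n => a n * y ^ n)%C _
    (a O * y ^ 0 + y * psum (fun n => a (S n)) y)%C); [reflexivity|simpl; ring|].
  apply (Cseries_incr (fun n => a n * y ^ n)%C).
  eapply Cseries_ext; [| |
    exact (is_series_scal (V := C_NormedModule) y _ _ (psum_correct _ _ _ _ Ha' Hy))].
  - intros n; unfold scal; simpl; unfold mult; simpl; ring.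
  - reflexivity.
Qed.

(* Coefficients of the divided difference [y |-> (f y - f z) / (y - z)] of [f = psum a]. *)
Definition ddc (a : nat -> C) (z : C) (n : nat) : C :=
  psum (fun m => a (m + S n)%nat) z.

(** The tail starting at index [n + 1] has bound [M / rho^(n+1)]; summing it at [z] contributes
    [rho / (rho - |z|)], and the weight [rho^n] cancels every remaining power of [rho]. *)
Lemma ddc_bound a rho M z :
  coef_bound a rho M -> Cmod z < rho ->
  coef_bound (ddc a z) rho (M / (rho - Cmod z)).
Proof.
  intros Ha Hz n; pose proof (Cmod_ge_0 z) as Hz0.
  pose proof (psum_bound _ _ _ z (coef_bound_shift a rho M (S n) ltac:(lra) Ha) Hz) as H.
  fold (ddc a z n) in H.
  apply Rmult_le_compat_r with (r := rho ^ n) in H; [|apply pow_le; lra].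
  eapply Rle_trans; [exact H|]; right; simpl; field.
  split; [lra|]; split; [|lra]; apply pow_nonzero; lra.
Qed.

(** The identity [f y - f z = (y - z) * g y] read on coefficients, where [g] is the divided
    difference. *)
Lemma ddc_step a rho M z n :
  coef_bound a rho M -> Cmod z < rho ->
  ddc a z n = (a (S n) + z * ddc a z (S n))%C.
Proof.
  intros Ha Hz; pose proof (Cmod_ge_0 z) as Hz0; unfold ddc.
  rewrite (psum_step _ rho _ z (coef_bound_shift a rho M (S n) ltac:(lra) Ha) Hz).
  simpl; do 2 f_equal; f_equal.
  apply functional_extensionality; intros m.
  f_equal; lia.
Qed.

(** No double series is rearranged: the recurrence [ddc_step] expresses the shifted series of [a]
    through the series of [ddc a z] and its shift, and splitting off constant terms does the
    rest. *)
Lemma psum_ddc a rho M y z :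
  coef_bound a rho M -> Cmod y < rho -> Cmod z < rho ->
  psum a y = (psum a z + (y - z) * psum (ddc a z) y)%C.
Proof.
  intros Ha Hy Hz; pose proof (Cmod_ge_0 z) as Hz0.
  pose proof (ddc_bound a rho M z Ha Hz) as Hb.
  pose proof (coef_bound_S (ddc a z) rho _ ltac:(lra) Hb) as Hb'.
  pose proof (psum_step _ _ _ y Hb Hy) as E1.
  pose proof (psum_step _ _ _ y Ha Hy) as E2.
  pose proof (psum_step _ _ _ z Ha Hz) as E3.
  assert (E4 : psum (fun n => a (S n)) y =
    (psum (ddc a z) y + - z * psum (fun n => ddc a z (S n)) y)%C).
  { apply psum_eq.
    eapply Cseries_ext; [| |apply (Cseries_lin (- z)%C);
      [exact (psum_correct _ _ _ y Hb Hy)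
      |exact (psum_correct _ _ _ y Hb' Hy)]].
    - intros n; cbv beta; rewrite (ddc_step a rho M z n Ha Hz); ring.
    - reflexivity. }
  assert (E5 : psum (fun n => a (S n)) z = ddc a z O).
  { unfold ddc; f_equal.
    apply functional_extensionality; intros m.
    f_equal; lia. }
  rewrite E5 in E3.
  rewrite E2, E3, E4.
  set (S := psum (ddc a z) y) in *.
  set (T := psum (fun n => ddc a z (Datatypes.S n)) y) in *.
  replace (y * (S + - z * T))%C with (y * S - z * (y * T))%C by ring.
  replace (y * T)%C with (S - ddc a z O)%C by (rewrite E1; ring).
  ring.
Qed.

Lemma psum_lipschitz a rho M rho' :
  0 < rho' < rho -> coef_bound a rho M ->
  exists K, 0 <= K /\ forall y z, Cmod y <= rho' -> Cmod z <= rho' ->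
    Cmod (psum a y - psum a z) <= K * Cmod (y - z).
Proof.
  intros Hr Ha; pose proof (coef_bound_pos _ _ _ Ha) as HM.
  (* One factor [1 / (rho - rho')] bounds the coefficients of the divided difference uniformly in
     [z], the other bounds its sum at [y]. *)
  exists (M / (rho - rho') * rho / (rho - rho')); split.
  { apply Rdiv_le_0_compat; [|lra].
    apply Rmult_le_pos; [apply Rdiv_le_0_compat|]; lra. }
  intros y z Hy Hz.
  rewrite (psum_ddc a rho M y z) by (trivial; lra).
  replace (psum a z + (y - z) * psum (ddc a z) y - psum a z)%C
    with (psum (ddc a z) y * (y - z))%C by ring.
  rewrite Cmod_mult; apply Rmult_le_compat_r; [apply Cmod_ge_0|].
  assert (Hb : coef_bound (ddc a z) rho (M / (rho - rho'))).
  { intros n; eapply Rle_trans; [apply (ddc_bound a rho M z Ha); lra|].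
    apply Rmult_le_compat_l; [lra|]; apply Rinv_le_contravar; lra. }
  eapply Rle_trans; [apply (psum_bound _ _ _ y Hb); lra|].
  apply Rmult_le_compat_l; [|apply Rinv_le_contravar; lra].
  apply Rmult_le_pos; [apply Rdiv_le_0_compat|]; lra.
Qed.

Lemma Cmod_sub_eq_0 (x y : C) : Cmod (x - y) = 0 -> x = y.
Proof.
  intros H; apply Cmod_eq_0 in H.
  replace x with (x - y + y)%C by ring; rewrite H; ring.
Qed.

(* Stated with [Cmod] rather than through [is_derive], because the uniform structures
   that Coquelicot puts on [C] as a ring and as a product do not unify. *)
Definition C_diff (f : C -> C) (z l : C) : Prop :=
  forall eps, 0 < eps -> exists del, 0 < del /\
    forall y, Cmod (y - z) < del ->
      Cmod (f y - f z - (y - z) * l) <= eps * Cmod (y - z).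

Definition C_cont (f : C -> C) (z : C) : Prop :=
  forall eps, 0 < eps -> exists del, 0 < del /\
    forall y, Cmod (y - z) < del -> Cmod (f y - f z) < eps.

Lemma Cmod_le_plus_sub (y z : C) : Cmod y <= Cmod z + Cmod (y - z).
Proof.
  replace y with (z + (y - z))%C at 1 by ring; apply Cmod_triangle.
Qed.

Lemma psum_cont a rho M z :
  coef_bound a rho M -> Cmod z < rho -> C_cont (psum a) z.
Proof.
  intros Ha Hz eps He; pose proof (Cmod_ge_0 z) as Hz0.
  destruct (psum_lipschitz a rho M ((Cmod z + rho) / 2) ltac:(lra) Ha) as (K & HK & HL).
  exists (Rmin ((rho - Cmod z) / 2) (eps / (K + 1))); split.
  { apply Rmin_pos; [lra|apply Rdiv_lt_0_compat; lra]. }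
  intros y Hy.
  pose proof (Rmin_l ((rho - Cmod z) / 2) (eps / (K + 1))) as H1.
  pose proof (Rmin_r ((rho - Cmod z) / 2) (eps / (K + 1))) as H2.
  pose proof (Cmod_le_plus_sub y z) as H3.
  eapply Rle_lt_trans; [apply HL; lra|].
  assert (H4 : Cmod (y - z) < eps / (K + 1)) by lra.
  apply Rmult_lt_compat_r with (r := K + 1) in H4; [|lra].
  replace (eps / (K + 1) * (K + 1)) with eps in H4 by (field; lra).
  pose proof (Cmod_ge_0 (y - z)); nra.
Qed.

(** The difference quotient is itself the power series of [ddc a z], so differentiability at [z]
    reduces to continuity of that series. *)
Lemma psum_diff a rho M z :
  coef_bound a rho M -> Cmod z < rho -> C_diff (psum a) z (psum (ddc a z) z).
Proof.
  intros Ha Hz eps He; pose proof (Cmod_ge_0 z) as Hz0.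
  pose proof (ddc_bound a rho M z Ha Hz) as Hb.
  destruct (psum_cont _ _ _ z Hb Hz eps He) as (del & Hd & HL).
  exists (Rmin del (rho - Cmod z)); split; [apply Rmin_pos; lra|].
  intros y Hy.
  pose proof (Rmin_l del (rho - Cmod z)) as H1.
  pose proof (Rmin_r del (rho - Cmod z)) as H2.
  pose proof (Cmod_le_plus_sub y z) as H3.
  rewrite (psum_ddc a rho M y z) by (trivial; lra).
  replace (psum a z + (y - z) * psum (ddc a z) y - psum a z - (y - z) * psum (ddc a z) z)%C
    with ((psum (ddc a z) y - psum (ddc a z) z) * (y - z))%C by ring.
  rewrite Cmod_mult; apply Rmult_le_compat_r; [apply Cmod_ge_0|].
  left; apply HL; lra.
Qed.

(** Bernoulli's inequality [1 + n * h <= (1 + h)^n] with [h = 1 / q - 1]. *)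
Lemma INR_mult_pow_bounded q : 0 <= q < 1 -> exists K, forall n, INR n * q ^ n <= K.
Proof.
  intros Hq; destruct (Req_dec q 0) as [->|Hq0].
  - exists 0; intros [|n]; simpl; [lra|]; rewrite Rmult_0_l; lra.
  - exists (/ (/ q - 1)); intros n.
    assert (H1 : 1 < / q) by (rewrite <- Rinv_1; apply Rinv_lt_contravar; lra).
    pose proof (Rle_pow_lin (/ q - 1) n ltac:(lra)) as H.
    replace (1 + (/ q - 1)) with (/ q) in H by ring.
    rewrite pow_inv in H.
    assert (Hp : 0 < q ^ n) by (apply pow_lt; lra).
    apply Rmult_le_compat_r with (r := q ^ n) in H; [|lra].
    rewrite Rinv_l in H by lra.
    apply Rmult_le_reg_r with (/ q - 1); [lra|].
    rewrite Rinv_l by lra.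
    lra.
Qed.

(* Abel summation: with [T n = sum_{m > n} a m z^(m-1)], the derivative
   [sum_n T n] equals [sum_n (n+1) a (n+1) z^n], as [n T n] tends to [0]. *)
Lemma psum_ddc_diag a rho M z :
  coef_bound a rho M -> Cmod z < rho ->
  is_Cseries (fun n => RtoC (INR (S n)) * a (S n) * z ^ n)%C (psum (ddc a z) z).
Proof.
  intros Ha Hz; pose proof (Cmod_ge_0 z) as Hz0.
  pose proof (ddc_bound a rho M z Ha Hz) as Hb.
  pose proof (psum_correct _ _ _ z Hb Hz) as HS.
  pose proof (coef_bound_pos _ _ _ Hb) as HM.
  set (b := ddc a z) in *.
  assert (Hsum : forall n,
    sum_n (G := C_AbelianMonoid) (fun n => RtoC (INR (S n)) * a (S n) * z ^ n)%C n =
    (sum_n (G := C_AbelianMonoid) (fun n => b n * z ^ n)%C n +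
     - (RtoC (INR (S n)) * b (S n) * z ^ (S n)))%C).
  { intros n; induction n as [|n IH].
    - rewrite !sum_O; unfold b; rewrite (ddc_step a rho M z 0 Ha Hz); simpl; ring.
    - rewrite !sum_Sn, IH.
      pose proof (ddc_step a rho M z (S n) Ha Hz) as E; fold b in E.
      generalize (sum_n (G := C_AbelianMonoid) (fun n => b n * z ^ n)%C n); intros A.
      change ((A + - (RtoC (INR (S n)) * b (S n) * z ^ S n) +
               RtoC (INR (S (S n))) * a (S (S n)) * z ^ S n)%C =
              (A + b (S n) * z ^ S n +
               - (RtoC (INR (S (S n))) * b (S (S n)) * (z * z ^ S n)))%C).
      rewrite E, (S_INR (S n)), RtoC_plus; ring. }
  assert (Hlim : filterlim (fun n => - (RtoC (INR (S n)) * b (S n) * z ^ (S n)))%C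
     eventually (locally (T := C_NormedModule) (@zero C_NormedModule))).
  { apply filterlim_norm_zero; try apply _.
    (* The intermediate radius splits [|z|^n] into [rho^n], [(rho1 / rho)^n] and [(|z| / rho1)^n]:
       the first is absorbed by the coefficient bound, the second by the factor [n], and the third
       tends to 0. *)
    set (rho1 := (Cmod z + rho) / 2).
    destruct (INR_mult_pow_bounded (rho1 / rho)) as [K HK].
    { unfold rho1; split; [apply Rdiv_le_0_compat; lra|].
      apply Rmult_lt_reg_r with rho; [lra|]; field_simplify; lra. }
    assert (Hg : is_lim_seq (fun n => M / (rho - Cmod z) * K * (Cmod z / rho1) ^ (S n))
              (Finite 0)).
    { replace (Finite 0) with (Rbar_mult (M / (rho - Cmod z) * K) (Finite 0))
        by (simpl; f_equal; ring).
      apply is_lim_seq_scal_l.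
      apply (is_lim_seq_incr_1 (fun n => (Cmod z / rho1) ^ n)).
      apply is_lim_seq_geom, geom_ratio_lt; unfold rho1; lra. }
    refine (is_lim_seq_le_le (fun _ => 0) _ _ (Finite 0) _ (is_lim_seq_const 0) Hg).
    intros n; split; [apply norm_ge_0|].
    change (Cmod (- (RtoC (INR (S n)) * b (S n) * z ^ (S n))) <=
            M / (rho - Cmod z) * K * (Cmod z / rho1) ^ (S n)).
    rewrite Cmod_opp, !Cmod_mult, Cmod_pow, Cmod_R, Rabs_pos_eq by apply pos_INR.
    assert (Hr1 : 0 < rho1) by (unfold rho1; lra).
    replace (Cmod z ^ S n) with
      (rho ^ S n * (rho1 / rho) ^ S n * (Cmod z / rho1) ^ S n)
      by (rewrite <- !Rpow_mult_distr; f_equal; field; lra).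
    set (N := S n).
    replace (INR N * Cmod (b N) * (rho ^ N * (rho1 / rho) ^ N * (Cmod z / rho1) ^ N))
      with ((Cmod (b N) * rho ^ N) * (INR N * (rho1 / rho) ^ N) * (Cmod z / rho1) ^ N)
      by ring.
    apply Rmult_le_compat_r; [apply pow_le, Rdiv_le_0_compat; lra|].
    apply Rmult_le_compat; try apply HK; try apply Hb;
      apply Rmult_le_pos; try apply Cmod_ge_0; try apply pos_INR;
      apply pow_le; try lra; apply Rdiv_le_0_compat; lra. }
  unfold is_series.
  replace (psum b z) with (@plus C_NormedModule (psum b z) (@zero C_NormedModule))
    by apply plus_zero_r.
  eapply filterlim_ext; [intros n; symmetry; apply Hsum|].
  exact (filterlim_comp_2 _ _ _ HS Hlim (filterlim_plus (V := C_NormedModule) _ _)).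
Qed.

(** * Primitives and uniqueness of coefficients *)

Definition prim_coef (a : nat -> C) (n : nat) : C :=
  match n with O => 0%C | S m => (a m / RtoC (INR (S m)))%C end.

Lemma prim_coef_bound a rho M :
  0 < rho -> coef_bound a rho M -> coef_bound (prim_coef a) rho (M * rho).
Proof.
  intros Hr Ha; pose proof (coef_bound_pos _ _ _ Ha) as HM.
  intros [|n]; unfold prim_coef.
  - rewrite Cmod_0; nra.
  - assert (H1 : 1 <= INR (S n)) by (rewrite S_INR; pose proof (pos_INR n); lra).
    rewrite Cmod_div by (intros E; apply RtoC_inj in E; lra).
    rewrite Cmod_R, Rabs_pos_eq by lra.
    specialize (Ha n).
    replace (Cmod (a n) / INR (S n) * rho ^ S n)
      with ((Cmod (a n) * rho ^ n) * rho * / INR (S n)) by (simpl pow; field; lra).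
    rewrite <- (Rmult_1_r (M * rho)).
    pose proof (Cmod_ge_0 (a n)).
    assert (0 <= rho ^ n) by (apply pow_le; lra).
    assert (0 <= Cmod (a n) * rho ^ n) by (now apply Rmult_le_pos).
    apply Rmult_le_compat.
    + apply Rmult_le_pos; lra.
    + left; apply Rinv_0_lt_compat; lra.
    + apply Rmult_le_compat_r; lra.
    + rewrite <- Rinv_1; apply Rinv_le_contravar; lra.
Qed.

(** The derivative given by [psum_diff] is a divided difference on the diagonal; [psum_ddc_diag]
    turns it into the termwise derivative, where the factors [n + 1] cancel. *)
Lemma psum_primitive a rho M z :
  coef_bound a rho M -> Cmod z < rho ->
  C_diff (psum (prim_coef a)) z (psum a z).
Proof.
  intros Ha Hz; pose proof (Cmod_ge_0 z) as Hz0.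
  pose proof (prim_coef_bound a rho M ltac:(lra) Ha) as Hp.
  replace (psum a z) with (psum (ddc (prim_coef a) z) z).
  { now apply (psum_diff _ rho (M * rho)). }
  symmetry; apply psum_eq.
  eapply Cseries_ext; [| reflexivity | exact (psum_ddc_diag _ _ _ z Hp Hz)].
  intros n; cbv beta; change (prim_coef a (S n)) with (a n / RtoC (INR (S n)))%C; field.
  intros E; apply RtoC_inj in E.
  pose proof (S_INR n); pose proof (pos_INR n); lra.
Qed.

(** Evaluation at 0 compares the constant terms; subtracting them and dividing by [y] leaves the
    same problem for the shifted sequences. *)
Lemma psum_coef_unique a b rho M M' :
  0 < rho -> coef_bound a rho M -> coef_bound b rho M' ->
  (forall y, Cmod y < rho -> psum a y = psum b y) -> forall n, a n = b n.
Proof.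
  intros Hr Ha Hb E n; revert a b M M' Ha Hb E.
  assert (H0 : forall a b M M', coef_bound a rho M -> coef_bound b rho M' ->
    (forall y, Cmod y < rho -> psum a y = psum b y) -> a O = b O).
  { intros a b M M' Ha Hb E; specialize (E 0%C).
    rewrite Cmod_0 in E; specialize (E Hr).
    rewrite (psum_step a rho M), (psum_step b rho M') in E
      by (trivial; rewrite Cmod_0; lra).
    rewrite !Cmult_0_l, !Cplus_0_r in E; exact E. }
  assert (Hshift : forall c K, coef_bound c rho K ->
    coef_bound (fun n => c (S n)) rho (K / rho)) by (intros; now apply coef_bound_S).
  induction n as [|n IH]; intros a b M M' Ha Hb E; [now apply (H0 a b M M')|].
  apply (IH (fun n => a (S n)) (fun n => b (S n)) _ _ (Hshift _ _ Ha) (Hshift _ _ Hb)).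
  pose proof (H0 a b M M' Ha Hb E) as E0.
  assert (Hnz : forall y : C, y <> 0%C -> Cmod y < rho ->
    psum (fun n => a (S n)) y = psum (fun n => b (S n)) y).
  { intros y Hy0 Hy; specialize (E y Hy).
    rewrite (psum_step a rho M), (psum_step b rho M'), E0 in E by trivial.
    assert (E' : (y * psum (fun n => a (S n)) y = y * psum (fun n => b (S n)) y)%C).
    { replace (y * psum (fun n => a (S n)) y)%C
        with (b O + y * psum (fun n => a (S n)) y - b O)%C by ring.
      rewrite E; ring. }
    apply (f_equal (fun x => / y * x)%C) in E'.
    rewrite !Cmult_assoc, Cinv_l, !Cmult_1_l in E' by exact Hy0; exact E'. }
  intros y Hy; destruct (Ceq_dec y 0) as [->|Hy0]; [|now apply Hnz].
  (* at the origin the equality follows by continuity *)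
  destruct (Req_dec (Cmod (psum (fun n => a (S n)) 0 - psum (fun n => b (S n)) 0)) 0)
    as [Z|NZ].
  { now apply Cmod_sub_eq_0. }
  exfalso.
  set (d := Cmod _) in NZ.
  assert (Hd : 0 < d) by (pose proof (Cmod_ge_0 (psum (fun n => a (S n)) 0 - psum (fun n => b (S n)) 0)); unfold d in *; lra).
  destruct (psum_cont _ _ _ 0%C (Hshift _ _ Ha) Hy (d / 2) ltac:(lra)) as (d1 & Hd1 & C1).
  destruct (psum_cont _ _ _ 0%C (Hshift _ _ Hb) Hy (d / 2) ltac:(lra)) as (d2 & Hd2 & C2).
  (* A nonzero real point where both shifted sums are within [d / 2] of their values at 0; they
     agree there, so [d] would be smaller than itself. *)
  set (t := Rmin (Rmin d1 d2) rho / 2).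
  assert (Ht : 0 < t /\ t < d1 /\ t < d2 /\ t < rho).
  { assert (0 < Rmin (Rmin d1 d2) rho) by (repeat apply Rmin_pos; lra).
    pose proof (Rmin_l (Rmin d1 d2) rho); pose proof (Rmin_r (Rmin d1 d2) rho).
    pose proof (Rmin_l d1 d2); pose proof (Rmin_r d1 d2); unfold t; lra. }
  specialize (C1 (RtoC t)); specialize (C2 (RtoC t)).
  replace (RtoC t - 0)%C with (RtoC t) in C1, C2 by ring.
  rewrite Cmod_R, Rabs_pos_eq in C1, C2 by lra.
  specialize (C1 ltac:(lra)); specialize (C2 ltac:(lra)).
  rewrite (Hnz (RtoC t)) in C1; [|intros X; apply RtoC_inj in X; lra
    |rewrite Cmod_R, Rabs_pos_eq; lra].
  assert (d <= Cmod (psum (fun n => b (S n)) t - psum (fun n => a (S n)) 0) +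
               Cmod (psum (fun n => b (S n)) t - psum (fun n => b (S n)) 0)); [|lra].
  rewrite <- (Cmod_opp (psum (fun n => b (S n)) t - psum (fun n => a (S n)) 0)).
  unfold d; eapply Rle_trans; [|apply Cmod_triangle].
  right; f_equal; ring.
Qed.

(** * Path integrals of functions with a primitive *)

Notation is_Cderive := (is_derive (K := R_AbsRing) (V := C_R_NormedModule)).
Notation is_CRInt := (is_RInt (V := C_R_NormedModule)).
Notation C_continuous := (continuous (U := C_UniformSpace)).

(** Real integration sees [C] as the product of two copies of [R]; its norm being the modulus, all
    estimates can be written with [Cmod]. *)
Lemma norm_C_R (x : C) : norm (V := C_R_NormedModule) x = Cmod x.
Proof.
  destruct x as [x y]; unfold norm; simpl; unfold prod_norm, norm; simpl.
  unfold Cmod, abs; simpl.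
  now rewrite !Rmult_1_r, <- !Rabs_mult, !Rabs_pos_eq by nra.
Qed.

Lemma scal_C_R (r : R) (x : C) : scal (V := C_R_NormedModule) r x = (RtoC r * x)%C.
Proof.
  apply injective_projections; simpl; unfold scal; simpl; unfold mult; simpl; ring.
Qed.

Lemma C_continuousE {T : UniformSpace} (h : T -> C) (t : T) :
  C_continuous h t <->
  forall eps, 0 < eps -> locally t (fun s => Cmod (h s - h t) < eps).
Proof.
  unfold continuous; split; intros H.
  - intros eps He.
    pose proof (proj1 (filterlim_locally_ball_norm (U := C_R_NormedModule) h (h t)) H
      (mkposreal eps He)) as H'.
    revert H'; apply filter_imp; intros s Hs.
    unfold ball_norm in Hs; rewrite norm_C_R in Hs; exact Hs.
  - apply (proj2 (filterlim_locally_ball_norm (U := C_R_NormedModule) h (h t))).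
    intros eps; generalize (H eps (cond_pos eps)); apply filter_imp; intros s Hs.
    unfold ball_norm; rewrite norm_C_R; exact Hs.
Qed.

Lemma C_cont_comp {T : UniformSpace} (f : C -> C) (h : T -> C) (t : T) :
  C_cont f (h t) -> C_continuous h t -> C_continuous (fun s => f (h s)) t.
Proof.
  intros Hf Hh; apply C_continuousE; intros eps He.
  destruct (Hf eps He) as (del & Hd & H).
  generalize (proj1 (C_continuousE h t) Hh del Hd); apply filter_imp; auto.
Qed.

Lemma C_continuous_plus {T : UniformSpace} (f g : T -> C) (t : T) :
  C_continuous f t -> C_continuous g t -> C_continuous (fun s => f s + g s)%C t.
Proof. apply (continuous_plus (V := C_R_NormedModule)). Qed.

Lemma C_continuous_mult {T : UniformSpace} (f g : T -> C) (t : T) :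
  C_continuous f t -> C_continuous g t -> C_continuous (fun s => f s * g s)%C t.
Proof.
  intros Hf Hg; apply C_continuousE; intros eps He.
  set (A := Cmod (f t)); set (B := Cmod (g t)).
  assert (HA : 0 <= A) by apply Cmod_ge_0.
  assert (HB : 0 <= B) by apply Cmod_ge_0.
  set (d := Rmin 1 (eps / (A + B + 1))).
  assert (Hd : 0 < d) by (apply Rmin_pos; [lra|apply Rdiv_lt_0_compat; lra]).
  generalize (filter_and _ _ (proj1 (C_continuousE f t) Hf d Hd)
                             (proj1 (C_continuousE g t) Hg d Hd)).
  apply filter_imp; intros s [H1 H2].
  replace (f s * g s - f t * g t)%C
    with ((f s - f t) * g s + f t * (g s - g t))%C by ring.
  eapply Rle_lt_trans; [apply Cmod_triangle|]; rewrite !Cmod_mult; fold A.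
  pose proof (Cmod_le_plus_sub (g s) (g t)) as H3; fold B in H3.
  pose proof (Rmin_l 1 (eps / (A + B + 1))) as H4; fold d in H4.
  pose proof (Rmin_r 1 (eps / (A + B + 1))) as H5; fold d in H5.
  apply Rmult_le_compat_r with (r := A + B + 1) in H5; [|lra].
  replace (eps / (A + B + 1) * (A + B + 1)) with eps in H5 by (field; lra).
  pose proof (Cmod_ge_0 (f s - f t)); pose proof (Cmod_ge_0 (g s - g t)).
  assert (Cmod (f s - f t) * Cmod (g s) <= Cmod (f s - f t) * (B + 1))
    by (apply Rmult_le_compat_l; lra).
  assert (Cmod (f s - f t) * (B + 1) < d * (B + 1)) by (apply Rmult_lt_compat_r; lra).
  assert (A * Cmod (g s - g t) <= A * d) by (apply Rmult_le_compat_l; lra).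
  lra.
Qed.

Lemma C_continuous_fst {T : UniformSpace} (f : T -> C) (t : T) :
  C_continuous f t -> continuous (U := R_UniformSpace) (fun s => fst (f s)) t.
Proof.
  intros Hf; apply (continuous_comp f (fun z : C => fst z)); [exact Hf|].
  destruct (f t); apply continuous_fst.
Qed.

Lemma C_continuous_snd {T : UniformSpace} (f : T -> C) (t : T) :
  C_continuous f t -> continuous (U := R_UniformSpace) (fun s => snd (f s)) t.
Proof.
  intros Hf; apply (continuous_comp f (fun z : C => snd z)); [exact Hf|].
  destruct (f t); apply continuous_snd.
Qed.

Lemma is_CderiveE (h : R -> C) (t : R) (v : C) :
  is_Cderive h t v <->
  forall eps, 0 < eps ->
    locally t (fun s => Cmod (h s - h t - RtoC (s - t) * v) <= eps * Rabs (s - t)).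
Proof.
  split.
  - intros [_ H] eps He.
    generalize (H t (fun P HP => HP) (mkposreal eps He)); apply filter_imp; intros s Hs.
    rewrite norm_C_R, scal_C_R in Hs; exact Hs.
  - intros H; split; [apply (is_linear_scal_l (V := C_R_NormedModule))|].
    intros x Hx; apply (is_filter_lim_locally_unique (V := AbsRing_NormedModule R_AbsRing)) in Hx; subst x.
    intros eps; generalize (H eps (cond_pos eps)); apply filter_imp; intros s Hs.
    rewrite norm_C_R, scal_C_R; exact Hs.
Qed.

Lemma is_Cderive_continuous (h : R -> C) (t : R) (v : C) :
  is_Cderive h t v -> C_continuous h t.
Proof.
  intros H; apply (ex_derive_continuous (V := C_R_NormedModule)); now exists v.
Qed.

(** A chain rule mixing a complex derivative outside with a real one inside. The error is the error
    of [F] at the increment [D] of [h], plus [l] times the error of [h]; each gets half of [eps]. *)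
Lemma is_Cderive_comp (F : C -> C) (h : R -> C) (t : R) (l v : C) :
  C_diff F (h t) l -> is_Cderive h t v -> is_Cderive (fun s => F (h s)) t (l * v)%C.
Proof.
  intros HF Hh; apply is_CderiveE; intros eps He.
  set (V := Cmod v); set (L := Cmod l).
  assert (HV : 0 <= V) by apply Cmod_ge_0.
  assert (HL : 0 <= L) by apply Cmod_ge_0.
  destruct (HF (eps / (2 * (V + 1)))) as (del & Hd & H).
  { apply Rdiv_lt_0_compat; lra. }
  pose proof (proj1 (C_continuousE h t) (is_Cderive_continuous h t v Hh) del Hd) as H1.
  (* The cap 1 ensures that [D] has modulus at most [(V + 1) * a]; the other term makes [e * L] at
     most [eps / 2]. *)
  set (e := Rmin 1 (eps / (2 * (L + 1)))).
  assert (He' : 0 < e) by (apply Rmin_pos; [lra|apply Rdiv_lt_0_compat; lra]).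
  pose proof (proj1 (is_CderiveE h t v) Hh e He') as H2.
  generalize (filter_and _ _ H1 H2); apply filter_imp; intros s [H3 H4].
  specialize (H _ H3).
  set (D := (h s - h t)%C) in *.
  set (a := Rabs (s - t)) in *; assert (Ha : 0 <= a) by apply Rabs_pos.
  replace (F (h s) - F (h t) - RtoC (s - t) * (l * v))%C
    with ((F (h s) - F (h t) - D * l) + (D - RtoC (s - t) * v) * l)%C by ring.
  eapply Rle_trans; [apply Cmod_triangle|]; rewrite (Cmod_mult _ l); fold L.
  pose proof (Rmin_l 1 (eps / (2 * (L + 1)))) as H5; fold e in H5.
  pose proof (Rmin_r 1 (eps / (2 * (L + 1)))) as H6; fold e in H6.
  assert (HD : Cmod D <= (V + 1) * a).
  { replace D with (RtoC (s - t) * v + (D - RtoC (s - t) * v))%C by ring.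
    eapply Rle_trans; [apply Cmod_triangle|].
    rewrite Cmod_mult, Cmod_R; fold V a.
    assert (e * a <= 1 * a) by (apply Rmult_le_compat_r; lra); lra. }
  assert (E1 : eps / (2 * (V + 1)) * Cmod D <= eps / 2 * a).
  { eapply Rle_trans; [apply Rmult_le_compat_l; [|exact HD]|].
    - apply Rdiv_le_0_compat; lra.
    - right; field; lra. }
  assert (E2 : Cmod (D - RtoC (s - t) * v) * L <= eps / 2 * a).
  { apply Rle_trans with (e * a * L); [apply Rmult_le_compat_r; lra|].
    assert (e * (L + 1) <= eps / 2).
    { apply Rmult_le_compat_r with (r := L + 1) in H6; [|lra].
      replace (eps / (2 * (L + 1)) * (L + 1)) with (eps / 2) in H6 by (field; lra); lra. }
    assert (e * L <= eps / 2) by lra.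
    replace (e * a * L) with (e * L * a) by ring; apply Rmult_le_compat_r; lra. }
  lra.
Qed.

Lemma is_Cderive_fst (h : R -> C) (t : R) (v : C) :
  is_Cderive h t v -> is_derive (fun s => fst (h s)) t (fst v).
Proof.
  intros H.
  exact (filterdiff_comp h (fun z : R_NormedModule * R_NormedModule => fst z)
    _ _ H (filterdiff_linear _ is_linear_fst)).
Qed.

Lemma is_Cderive_snd (h : R -> C) (t : R) (v : C) :
  is_Cderive h t v -> is_derive (fun s => snd (h s)) t (snd v).
Proof.
  intros H.
  exact (filterdiff_comp h (fun z : R_NormedModule * R_NormedModule => snd z)
    _ _ H (filterdiff_linear _ is_linear_snd)).
Qed.

Lemma is_CRInt_unique (f : R -> C) (a b : R) (v w : C) :
  is_CRInt f a b v -> is_CRInt f a b w -> v = w.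
Proof.
  intros Hv Hw.
  rewrite <- (is_RInt_unique (V := C_R_CompleteNormedModule) f a b v Hv).
  exact (is_RInt_unique (V := C_R_CompleteNormedModule) f a b w Hw).
Qed.

(** Linearity over the real module handles real scalars; for a complex [c] the product is integrated
    component by component. *)
Lemma is_CRInt_scal (c : C) (f : R -> C) (a b : R) (v : C) :
  is_CRInt f a b v -> is_CRInt (fun t => c * f t)%C a b (c * v)%C.
Proof.
  intros H.
  pose proof (is_RInt_fct_extend_fst (U := R_NormedModule) (V := R_NormedModule) f a b v H) as H1.
  pose proof (is_RInt_fct_extend_snd (U := R_NormedModule) (V := R_NormedModule) f a b v H) as H2.
  apply (is_RInt_fct_extend_pair (U := R_NormedModule) (V := R_NormedModule)
    (fun t => (c * f t)%C)).
  - exact (is_RInt_minus _ _ _ _ _ _ (is_RInt_scal _ a b (fst c) _ H1)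
             (is_RInt_scal _ a b (snd c) _ H2)).
  - exact (is_RInt_plus _ _ _ _ _ _ (is_RInt_scal _ a b (fst c) _ H2)
             (is_RInt_scal _ a b (snd c) _ H1)).
Qed.

Lemma is_CRInt_lin (c : C) (f g : R -> C) (a b : R) (v w : C) :
  is_CRInt f a b v -> is_CRInt g a b w ->
  is_CRInt (fun t => f t + c * g t)%C a b (v + c * w)%C.
Proof.
  intros Hf Hg.
  exact (is_RInt_plus (V := C_R_NormedModule) _ _ _ _ _ _ Hf (is_CRInt_scal c g a b w Hg)).
Qed.

(** Interior points only: there the agreement of [g] with its extension [h] on the closed interval
    is an agreement on a neighbourhood. *)
Lemma path_derive_eq (g h : R -> C) (a b t : R) (v : C) :
  (forall s, a <= s <= b -> g s = h s) -> a < t < b -> is_Cderive h t v ->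
  path_derive g t = v.
Proof.
  intros Hgh Ht Hh.
  assert (Hloc : locally t (fun s => h s = g s)).
  { assert (Hp : 0 < Rmin (t - a) (b - t)) by (apply Rmin_pos; lra).
    exists (mkposreal _ Hp); intros s Hs.
    symmetry; apply Hgh.
    change (Rabs (s - t) < Rmin (t - a) (b - t)) in Hs.
    pose proof (Rmin_l (t - a) (b - t)); pose proof (Rmin_r (t - a) (b - t)).
    apply Rabs_lt_between in Hs; lra. }
  unfold path_derive; apply injective_projections; simpl.
  - rewrite <- (Derive_ext_loc (fun s => fst (h s)));
      [|revert Hloc; apply filter_imp; intros s Hs; now rewrite Hs].
    apply is_derive_unique, is_Cderive_fst, Hh.
  - rewrite <- (Derive_ext_loc (fun s => snd (h s)));
      [|revert Hloc; apply filter_imp; intros s Hs; now rewrite Hs].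
    apply is_derive_unique, is_Cderive_snd, Hh.
Qed.

Definition path_integrand (f : C -> C) (g : R -> C) (t : R) : C :=
  (f (g t) * path_derive g t)%C.

(** The integrand formed with the extension is continuous up to the end points and equals the true
    one inside, which gives the integral; its value comes from the fundamental theorem applied to
    the composite of [F] with the extension. *)
Lemma path_integral_piece (f : C -> C) (g : R -> C) (a b : R) :
  a < b -> C1_on g a b -> (forall t, a <= t <= b -> C_cont f (g t)) ->
  exists v : C, is_CRInt (path_integrand f g) a b v /\
    forall F, (forall t, a <= t <= b -> C_diff F (g t) (f (g t))) ->
      v = (F (g b) - F (g a))%C.
Proof.
  intros Hab (h & h' & Hd & Hc & Hgh) Hf.
  assert (Hmin : Rmin a b = a) by (apply Rmin_left; lra).
  assert (Hmax : Rmax a b = b) by (apply Rmax_right; lra).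
  assert (Hcont : forall t, Rmin a b <= t <= Rmax a b ->
    C_continuous (fun t => f (h t) * h' t)%C t).
  { rewrite Hmin, Hmax; intros t Ht; apply C_continuous_mult; [|apply Hc].
    apply C_cont_comp; [rewrite <- Hgh by exact Ht; now apply Hf|].
    exact (is_Cderive_continuous h t _ (Hd t)). }
  assert (Hext : forall t, Rmin a b < t < Rmax a b ->
    (f (h t) * h' t)%C = path_integrand f g t).
  { rewrite Hmin, Hmax; intros t Ht; unfold path_integrand.
    rewrite (path_derive_eq g h a b t (h' t) Hgh Ht (Hd t)), Hgh by lra; reflexivity. }
  destruct (ex_RInt_continuous (V := C_R_CompleteNormedModule) _ a b Hcont) as [v Hv].
  exists v; split; [exact (is_RInt_ext (V := C_R_NormedModule) _ _ _ _ _ Hext Hv)|].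
  intros F HF; apply (is_CRInt_unique _ a b v _ Hv).
  rewrite !Hgh by lra.
  refine (is_RInt_derive (V := C_R_CompleteNormedModule) (fun t => F (h t)) _ a b _ Hcont).
  rewrite Hmin, Hmax; intros t Ht; apply is_Cderive_comp; [|apply Hd].
  rewrite <- Hgh by exact Ht; now apply HF.
Qed.

(** The pieces are added along the subdivision; with a primitive the increments telescope to the
    difference between the two ends of the path, which is 0 as the path is closed. *)
Lemma path_integral_ex (f : C -> C) (g : closed_path) :
  (forall t, 0 <= t <= 1 -> C_cont f (g t)) ->
  exists v : C, is_CRInt (path_integrand f g) 0 1 v /\
    forall F, (forall t, 0 <= t <= 1 -> C_diff F (g t) (f (g t))) -> v = RtoC 0.
Proof.
  intros Hf; destruct g as [g [n (s & Hs0 & Hsn & Hs)] Hcl]; simpl in *.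
  assert (Hge : forall i, (i <= n)%nat -> 0 <= s i).
  { induction i as [|i IH]; intros Hi; [lra|].
    pose proof (proj1 (Hs i ltac:(lia))); specialize (IH ltac:(lia)); lra. }
  (* The upper bound is propagated downwards from [s n = 1], hence the induction on the distance to
     [n]. *)
  assert (Hle : forall i, (i <= n)%nat -> s (n - i)%nat <= 1).
  { induction i as [|i IH]; intros Hi; [rewrite Nat.sub_0_r; lra|].
    pose proof (proj1 (Hs (n - S i)%nat ltac:(lia))) as H.
    replace (S (n - S i)) with (n - i)%nat in H by lia.
    specialize (IH ltac:(lia)); lra. }
  assert (Hle' : forall i, (i <= n)%nat -> s i <= 1).
  { intros i Hi; specialize (Hle (n - i)%nat ltac:(lia)).
    replace (n - (n - i))%nat with i in Hle by lia; exact Hle. }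
  assert (Hm : forall m, (m <= n)%nat -> exists v : C,
    is_CRInt (path_integrand f g) 0 (s m) v /\
    forall F, (forall t, 0 <= t <= 1 -> C_diff F (g t) (f (g t))) ->
      v = (F (g (s m)) - F (g 0))%C).
  { induction m as [|m IH]; intros Hm.
    - exists (RtoC 0); rewrite Hs0; split; [|intros F _; ring].
      apply (is_RInt_point (V := C_R_NormedModule)).
    - destruct (IH ltac:(lia)) as (v & Hv & HvF).
      destruct (Hs m ltac:(lia)) as [Hlt Hc1].
      pose proof (Hge m ltac:(lia)); pose proof (Hle' (S m) ltac:(lia)).
      destruct (path_integral_piece f g (s m) (s (S m)) Hlt Hc1) as (w & Hw & HwF).
      { intros t Ht; apply Hf; lra. }
      exists (v + w)%C; split.
      + exact (is_RInt_Chasles (V := C_R_NormedModule) _ _ _ _ _ _ Hv Hw).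
      + intros F HF; rewrite (HvF F HF), (HwF F) by (intros t Ht; apply HF; lra); ring. }
  destruct (Hm n (Nat.le_refl n)) as (v & Hv & HvF); rewrite Hsn in *.
  exists v; split; [exact Hv|]; intros F HF.
  rewrite (HvF F HF), Hcl; ring.
Qed.

Lemma path_integral_correct (f : C -> C) (g : closed_path) :
  (forall t, 0 <= t <= 1 -> C_cont f (g t)) ->
  is_CRInt (path_integrand f g) 0 1 (path_integral f g).
Proof.
  intros Hf; destruct (path_integral_ex f g Hf) as (v & Hv & _).
  pose proof (is_RInt_unique (V := C_R_CompleteNormedModule) _ _ _ _ Hv) as E.
  change (path_integral f g = v) in E; now rewrite E.
Qed.

Lemma cycle_integral_ext (f h : C -> C) (gamma : cycle) :
  (forall w, in_trace gamma w -> f w = h w) ->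
  cycle_integral f gamma = cycle_integral h gamma.
Proof.
  induction gamma as [|p gamma IH]; intros H; [reflexivity|]; simpl; f_equal.
  - f_equal; unfold path_integral.
    apply (RInt_ext (V := C_R_CompleteNormedModule)).
    intros t Ht; rewrite Rmin_left, Rmax_right in Ht by lra.
    rewrite H; [reflexivity|].
    exists p; split; [now left|]; exists t; split; [lra|reflexivity].
  - apply IH; intros w (q & Hq & Hw); apply H; exists q; split; [now right|exact Hw].
Qed.

Lemma cycle_integral_lin (c : C) (f h : C -> C) (gamma : cycle) :
  (forall w, in_trace gamma w -> C_cont f w) ->
  (forall w, in_trace gamma w -> C_cont h w) ->
  cycle_integral (fun y => f y + c * h y)%C gamma =
  (cycle_integral f gamma + c * cycle_integral h gamma)%C.
Proof.
  induction gamma as [|p gamma IH]; intros Hf Hh; simpl; [ring|].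
  rewrite IH by (intros w (q & Hq & Hw); first [apply Hf|apply Hh]; exists q; split; [now right|exact Hw]).
  assert (Hin : forall t, 0 <= t <= 1 -> in_trace (p :: gamma) (snd p t)).
  { intros t Ht; exists p; split; [now left|]; exists t; split; [lra|reflexivity]. }
  assert (E : path_integral (fun y => f y + c * h y)%C (snd p) =
    (path_integral f (snd p) + c * path_integral h (snd p))%C).
  { apply (is_RInt_unique (V := C_R_CompleteNormedModule)).
    pose proof (is_CRInt_lin c _ _ _ _ _ _
      (path_integral_correct f (snd p) (fun t Ht => Hf _ (Hin t Ht)))
      (path_integral_correct h (snd p) (fun t Ht => Hh _ (Hin t Ht)))) as H.
    revert H; apply (is_RInt_ext (V := C_R_NormedModule)); intros t _.
    unfold path_integrand; match goal with |- ?a = ?b => change (@eq C a b) end; ring. }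
  rewrite E; ring.
Qed.

(** The means by which cycle integrals are shown to vanish: below it is applied to power series in
    [y] or in [1 / y] and to negative powers of [y - w]. *)
Lemma cycle_integral_exact (F f : C -> C) (gamma : cycle) :
  (forall w, in_trace gamma w -> C_cont f w) ->
  (forall w, in_trace gamma w -> C_diff F w (f w)) ->
  cycle_integral f gamma = 0%C.
Proof.
  induction gamma as [|p gamma IH]; intros Hf HF; simpl; [reflexivity|].
  rewrite IH by (intros w (q & Hq & Hw); first [apply Hf|apply HF]; exists q; split; [now right|exact Hw]).
  assert (Hin : forall t, 0 <= t <= 1 -> in_trace (p :: gamma) (snd p t)).
  { intros t Ht; exists p; split; [now left|]; exists t; split; [lra|reflexivity]. }
  destruct (path_integral_ex f (snd p) (fun t Ht => Hf _ (Hin t Ht))) as (v & Hv & H0).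
  pose proof (is_CRInt_unique _ _ _ _ _
    (path_integral_correct f (snd p) (fun t Ht => Hf _ (Hin t Ht))) Hv) as E.
  rewrite E, (H0 F (fun t Ht => HF _ (Hin t Ht))); ring.
Qed.

(** * Circles and winding numbers *)

Lemma C_diff_cont (f : C -> C) (z l : C) : C_diff f z l -> C_cont f z.
Proof.
  intros H eps He; destruct (H 1 ltac:(lra)) as (del & Hd & H1).
  pose proof (Cmod_ge_0 l) as Hl.
  exists (Rmin del (eps / (Cmod l + 2))); split.
  { apply Rmin_pos; [lra|apply Rdiv_lt_0_compat; lra]. }
  intros y Hy.
  pose proof (Rmin_l del (eps / (Cmod l + 2))) as H2.
  pose proof (Rmin_r del (eps / (Cmod l + 2))) as H3.
  specialize (H1 y ltac:(lra)).
  replace (f y - f z)%C with (f y - f z - (y - z) * l + (y - z) * l)%C by ring.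
  eapply Rle_lt_trans; [apply Cmod_triangle|]; rewrite (Cmod_mult _ l).
  assert (H4 : Cmod (y - z) < eps / (Cmod l + 2)) by lra.
  apply Rmult_lt_compat_r with (r := Cmod l + 2) in H4; [|lra].
  replace (eps / (Cmod l + 2) * (Cmod l + 2)) with eps in H4 by (field; lra).
  pose proof (Cmod_ge_0 (y - z)); lra.
Qed.

Lemma C_diff_loc (f g : C -> C) (z l : C) (r : R) :
  0 < r -> (forall y, Cmod (y - z) < r -> f y = g y) -> C_diff g z l -> C_diff f z l.
Proof.
  intros Hr Hfg Hg eps He; destruct (Hg eps He) as (del & Hd & H).
  exists (Rmin del r); split; [now apply Rmin_pos|]; intros y Hy.
  pose proof (Rmin_l del r); pose proof (Rmin_r del r).
  rewrite !Hfg; [apply H; lra| |lra].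
  replace (z - z)%C with (RtoC 0) by ring; rewrite Cmod_0; exact Hr.
Qed.

Lemma C_diff_id (z : C) : C_diff (fun y => y) z 1%C.
Proof.
  intros eps He; exists 1; split; [lra|]; intros y _.
  replace (y - z - (y - z) * 1)%C with (RtoC 0) by ring; rewrite Cmod_0.
  apply Rmult_le_pos; [lra|apply Cmod_ge_0].
Qed.

Lemma C_diff_translate (f : C -> C) (w z l : C) :
  C_diff f (z - w)%C l -> C_diff (fun y => f (y - w)%C) z l.
Proof.
  intros H eps He; destruct (H eps He) as (del & Hd & H1).
  exists del; split; [exact Hd|]; intros y Hy.
  specialize (H1 (y - w)%C).
  replace (y - w - (z - w))%C with (y - z)%C in H1 by ring; auto.
Qed.

Lemma C_diff_scal (c : C) (f : C -> C) (z l : C) :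
  C_diff f z l -> C_diff (fun y => c * f y)%C z (c * l)%C.
Proof.
  intros H eps He; pose proof (Cmod_ge_0 c) as Hc.
  destruct (H (eps / (Cmod c + 1))) as (del & Hd & H1).
  { apply Rdiv_lt_0_compat; lra. }
  exists del; split; [exact Hd|]; intros y Hy; specialize (H1 y Hy).
  replace (c * f y - c * f z - (y - z) * (c * l))%C
    with (c * (f y - f z - (y - z) * l))%C by ring.
  rewrite Cmod_mult.
  apply Rle_trans with ((Cmod c + 1) * (eps / (Cmod c + 1) * Cmod (y - z))).
  - apply Rmult_le_compat; try apply Cmod_ge_0; lra.
  - right; field; lra.
Qed.

Lemma C_diff_comp (F h : C -> C) (z l v : C) :
  C_diff F (h z) l -> C_diff h z v -> C_diff (fun y => F (h y)) z (l * v)%C.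
Proof.
  intros HF Hh eps He; pose proof (C_diff_cont h z v Hh) as Hc.
  set (V := Cmod v); set (L := Cmod l).
  assert (HV : 0 <= V) by apply Cmod_ge_0.
  assert (HL : 0 <= L) by apply Cmod_ge_0.
  destruct (HF (eps / (2 * (V + 1)))) as (del & Hd & H).
  { apply Rdiv_lt_0_compat; lra. }
  destruct (Hc del Hd) as (d1 & Hd1 & H1).
  set (e := Rmin 1 (eps / (2 * (L + 1)))).
  assert (He' : 0 < e) by (apply Rmin_pos; [lra|apply Rdiv_lt_0_compat; lra]).
  destruct (Hh e He') as (d2 & Hd2 & H2).
  exists (Rmin d1 d2); split; [now apply Rmin_pos|]; intros y Hy.
  pose proof (Rmin_l d1 d2); pose proof (Rmin_r d1 d2).
  specialize (H1 y ltac:(lra)); specialize (H2 y ltac:(lra)); specialize (H _ H1).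
  set (D := (h y - h z)%C) in *.
  set (a := Cmod (y - z)) in *; assert (Ha : 0 <= a) by apply Cmod_ge_0.
  replace (F (h y) - F (h z) - (y - z) * (l * v))%C
    with ((F (h y) - F (h z) - D * l) + (D - (y - z) * v) * l)%C by ring.
  eapply Rle_trans; [apply Cmod_triangle|]; rewrite (Cmod_mult _ l); fold L.
  pose proof (Rmin_l 1 (eps / (2 * (L + 1)))) as H5; fold e in H5.
  pose proof (Rmin_r 1 (eps / (2 * (L + 1)))) as H6; fold e in H6.
  assert (HD : Cmod D <= (V + 1) * a).
  { replace D with ((y - z) * v + (D - (y - z) * v))%C by ring.
    eapply Rle_trans; [apply Cmod_triangle|].
    rewrite Cmod_mult; fold V a.
    assert (e * a <= 1 * a) by (apply Rmult_le_compat_r; lra); lra. }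
  assert (E1 : eps / (2 * (V + 1)) * Cmod D <= eps / 2 * a).
  { eapply Rle_trans; [apply Rmult_le_compat_l; [|exact HD]|].
    - apply Rdiv_le_0_compat; lra.
    - right; field; lra. }
  assert (E2 : Cmod (D - (y - z) * v) * L <= eps / 2 * a).
  { apply Rle_trans with (e * a * L); [apply Rmult_le_compat_r; lra|].
    assert (e * (L + 1) <= eps / 2).
    { apply Rmult_le_compat_r with (r := L + 1) in H6; [|lra].
      replace (eps / (2 * (L + 1)) * (L + 1)) with (eps / 2) in H6 by (field; lra); lra. }
    assert (e * L <= eps / 2) by lra.
    replace (e * a * L) with (e * L * a) by ring; apply Rmult_le_compat_r; lra. }
  lra.
Qed.

Lemma C_diff_inv (z : C) : z <> 0%C -> C_diff (fun y => / y)%C z (- / (z * z))%C.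
Proof.
  intros Hz eps He; pose proof (proj1 (Cmod_gt_0 z) Hz) as Hm.
  set (m := Cmod z) in *.
  (* The error is exactly [(y - z)^2 / (z^2 * y)]. The first radius gives [|y| >= m / 2], so the
     error is at most [2 * |y - z|^2 / m^3]; the second radius makes this at most
     [eps * |y - z|]. *)
  exists (Rmin (m / 2) (eps * (m * m * m) / 2)); split.
  { apply Rmin_pos; [lra|].
    apply Rdiv_lt_0_compat; [|lra]; repeat apply Rmult_lt_0_compat; lra. }
  intros y Hy.
  pose proof (Rmin_l (m / 2) (eps * (m * m * m) / 2)) as H1.
  pose proof (Rmin_r (m / 2) (eps * (m * m * m) / 2)) as H2.
  assert (Hym : m / 2 <= Cmod y).
  { pose proof (Cmod_le_plus_sub z y) as H3; fold m in H3.
    replace (z - y)%C with (- (y - z))%C in H3 by ring; rewrite Cmod_opp in H3; lra. }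
  assert (Hy0 : y <> 0%C) by (apply Cmod_gt_0; lra).
  replace (/ y - / z - (y - z) * - / (z * z))%C
    with ((y - z) * / (z * z * y) * (y - z))%C by (field; split; assumption).
  rewrite Cmod_mult; apply Rmult_le_compat_r; [apply Cmod_ge_0|].
  assert (Hzzy : (z * z * y)%C <> 0%C).
  { apply Cmod_gt_0; rewrite !Cmod_mult; fold m.
    repeat apply Rmult_lt_0_compat; lra. }
  rewrite Cmod_mult, Cmod_inv, !Cmod_mult by exact Hzzy; fold m.
  assert (H4 : / (m * m * Cmod y) <= / (m * m * (m / 2))).
  { apply Rinv_le_contravar; [repeat apply Rmult_lt_0_compat; lra|].
    apply Rmult_le_compat_l; [nra|lra]. }
  assert (H5 : 0 < / (m * m * (m / 2)))
    by (apply Rinv_0_lt_compat; repeat apply Rmult_lt_0_compat; lra).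
  apply Rle_trans with (eps * (m * m * m) / 2 * / (m * m * (m / 2))).
  - apply Rmult_le_compat; [apply Cmod_ge_0| |lra|exact H4].
    left; apply Rinv_0_lt_compat; repeat apply Rmult_lt_0_compat; lra.
  - right; field; lra.
Qed.

Lemma C_diff_inv_sub (w z : C) :
  z <> w -> C_diff (fun y => / (y - w))%C z (- / ((z - w) * (z - w)))%C.
Proof.
  intros H; apply (C_diff_translate (fun y => / y)%C); apply C_diff_inv.
  intros E; apply H; replace z with (z - w + w)%C by ring; rewrite E; ring.
Qed.

(** Gives access to the closure properties of continuous maps; the ball of the product structure and
    the disk for the modulus are compared here. *)
Lemma C_contE (f : C -> C) (z : C) :
  C_cont f z <-> @continuous C_UniformSpace C_UniformSpace f z.
Proof.
  split.
  - intros H; apply (C_cont_comp (T := C_UniformSpace) f (fun y => y)); [exact H|].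
    apply continuous_id.
  - intros H eps He.
    destruct (proj1 (C_continuousE f z) H eps He) as [d Hd].
    exists d; split; [apply cond_pos|]; intros y Hy; apply Hd.
    apply C_NormedModule_mixin_compat1; exact Hy.
Qed.

Lemma C_cont_mult (f g : C -> C) (z : C) :
  C_cont f z -> C_cont g z -> C_cont (fun y => f y * g y)%C z.
Proof. rewrite !C_contE; apply C_continuous_mult. Qed.

Lemma C_cont_const (c z : C) : C_cont (fun _ => c) z.
Proof. apply C_contE, continuous_const. Qed.

Lemma C_cont_loc (f g : C -> C) (z : C) (r : R) :
  0 < r -> (forall y, Cmod (y - z) < r -> f y = g y) -> C_cont g z -> C_cont f z.
Proof.
  intros Hr Hfg Hg eps He; destruct (Hg eps He) as (del & Hd & H).
  exists (Rmin del r); split; [now apply Rmin_pos|]; intros y Hy.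
  pose proof (Rmin_l del r); pose proof (Rmin_r del r).
  rewrite !Hfg; [apply H; lra| |lra].
  replace (z - z)%C with (RtoC 0) by ring; rewrite Cmod_0; exact Hr.
Qed.

Lemma C_cont_inv_sub (w z : C) : z <> w -> C_cont (fun y => / (y - w))%C z.
Proof. intros H; exact (C_diff_cont _ _ _ (C_diff_inv_sub w z H)). Qed.

Lemma geom_coef_bound (c q : C) (rho : R) :
  0 <= rho -> Cmod q * rho <= 1 -> coef_bound (fun n => c * q ^ n)%C rho (Cmod c).
Proof.
  intros Hr Hq n; rewrite Cmod_mult, Cmod_pow, Rmult_assoc, <- Rpow_mult_distr.
  rewrite <- (Rmult_1_r (Cmod c)) at 2; apply Rmult_le_compat_l; [apply Cmod_ge_0|].
  rewrite <- (pow1 n); apply pow_incr; split; [|exact Hq].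
  apply Rmult_le_pos; [apply Cmod_ge_0|exact Hr].
Qed.

(** Shifting the coefficients multiplies the sum [S] by [q], so that [S = c + q * y * S]; since
    [|q * y| < 1], this can be solved for [S]. *)
Lemma psum_geom (c q y : C) (rho : R) :
  Cmod q * rho <= 1 -> Cmod y < rho ->
  (1 - q * y)%C <> 0%C /\ psum (fun n => c * q ^ n)%C y = (c / (1 - q * y))%C.
Proof.
  intros Hq Hy; pose proof (Cmod_ge_0 y) as Hy0.
  assert (Hne : (1 - q * y)%C <> 0%C).
  { intros E.
    assert (E' : (q * y)%C = 1%C) by (replace (q * y)%C with (1 - (1 - q * y))%C by ring; rewrite E; ring).
    apply (f_equal Cmod) in E'; rewrite Cmod_mult, Cmod_1 in E'.
    pose proof (Cmod_ge_0 q); destruct (Req_dec (Cmod q) 0); nra. }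
  split; [exact Hne|].
  pose proof (geom_coef_bound c q rho ltac:(lra) Hq) as Hb.
  pose proof (psum_step _ _ _ y Hb Hy) as E; cbv beta in E.
  assert (E2 : psum (fun n => c * q ^ S n)%C y = (q * psum (fun n => c * q ^ n) y)%C).
  { apply psum_eq.
    eapply Cseries_ext; [|reflexivity|
      exact (is_series_scal (V := C_NormedModule) q _ _ (psum_correct _ _ _ y Hb Hy))].
    intros n; unfold scal; simpl; unfold mult; simpl; ring. }
  rewrite E2 in E; set (S := psum _ y) in *.
  assert (E3 : (S * (1 - q * y))%C = c).
  { replace (S * (1 - q * y))%C with (S - y * (q * S))%C by ring.
    rewrite E at 1; simpl; ring. }
  rewrite <- E3; field; exact Hne.
Qed.

(** * Circles around the origin *)

Definition circ (rho t : R) : C :=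
  (rho * cos (2 * PI * t), rho * sin (2 * PI * t)).

Lemma Cmod_le_sum (z : C) : Cmod z <= Rabs (fst z) + Rabs (snd z).
Proof.
  destruct z as [x y]; simpl.
  replace (x, y) with (RtoC x + Ci * RtoC y)%C
    by (apply injective_projections; simpl; ring).
  eapply Rle_trans; [apply Cmod_triangle|].
  rewrite Cmod_mult, Cmod_Ci, !Cmod_R; lra.
Qed.

Lemma is_Cderive_pair (f g : R -> R) (t a b : R) :
  is_derive f t a -> is_derive g t b -> is_Cderive (fun s => (f s, g s)) t (a, b).
Proof.
  intros [_ Hf] [_ Hg]; apply is_CderiveE; intros eps He.
  assert (He2 : 0 < eps / 2) by lra.
  generalize (filter_and _ _ (Hf t (fun P HP => HP) (mkposreal _ He2))
                             (Hg t (fun P HP => HP) (mkposreal _ He2))).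
  apply filter_imp; intros s [H1 H2].
  change (Rabs (f s - f t - (s - t) * a) <= eps / 2 * Rabs (s - t)) in H1.
  change (Rabs (g s - g t - (s - t) * b) <= eps / 2 * Rabs (s - t)) in H2.
  eapply Rle_trans; [apply Cmod_le_sum|]; simpl.
  replace (f s + - f t + - ((s - t) * a - 0 * b)) with (f s - f t - (s - t) * a) by ring.
  replace (g s + - g t + - ((s - t) * b + 0 * a)) with (g s - g t - (s - t) * b) by ring.
  lra.
Qed.

Lemma circ_derive (rho t : R) :
  is_Cderive (circ rho) t (2 * PI * Ci * circ rho t)%C.
Proof.
  replace (2 * PI * Ci * circ rho t)%C
    with (- (2 * PI * (rho * sin (2 * PI * t))), 2 * PI * (rho * cos (2 * PI * t))).
  2:{ unfold circ; apply injective_projections; simpl; ring. }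
  apply is_Cderive_pair; auto_derive; trivial; ring.
Qed.

Lemma circ_continuous (rho t : R) : C_continuous (circ rho) t.
Proof. exact (is_Cderive_continuous _ _ _ (circ_derive rho t)). Qed.

Lemma Cmod_circ (rho t : R) : 0 <= rho -> Cmod (circ rho t) = rho.
Proof.
  intros Hr; unfold Cmod, circ; cbn [fst snd].
  replace ((rho * cos (2 * PI * t)) ^ 2 + (rho * sin (2 * PI * t)) ^ 2)
    with (rho * rho).
  - now apply sqrt_square.
  - pose proof (sin2_cos2 (2 * PI * t)) as H; unfold Rsqr in H.
    replace ((rho * cos (2 * PI * t)) ^ 2 + (rho * sin (2 * PI * t)) ^ 2)
      with (rho * rho * (sin (2 * PI * t) * sin (2 * PI * t) + cos (2 * PI * t) * cos (2 * PI * t)))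
      by ring.
    rewrite H; ring.
Qed.

Lemma circ_closed (rho : R) : circ rho 0 = circ rho 1.
Proof.
  unfold circ; rewrite Rmult_0_r, Rmult_1_r, cos_0, sin_0, cos_2PI, sin_2PI; reflexivity.
Qed.

Lemma circ_piecewise_C1 (rho : R) : piecewise_C1 (circ rho).
Proof.
  exists 1%nat, INR; split; [reflexivity|]; split; [reflexivity|].
  intros i Hi; split; [apply lt_INR; lia|].
  exists (circ rho), (fun t => 2 * PI * Ci * circ rho t)%C; split; [|split].
  - intros t; apply circ_derive.
  - intros t; apply C_continuous_mult; [apply continuous_const|apply circ_continuous].
  - reflexivity.
Qed.

Definition circle_path (rho : R) : closed_path :=
  Closed_path (circ rho) (circ_piecewise_C1 rho) (circ_closed rho).

Definition circle (rho : R) : cycle := (1%Z, circle_path rho) :: nil.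

Lemma in_trace_circle (rho : R) (y : C) :
  0 <= rho -> in_trace (circle rho) y -> Cmod y = rho.
Proof.
  intros Hr (p & [<-|[]] & t & _ & <-); now apply Cmod_circ.
Qed.

(** On the circle [dy = 2 * PI * i * y dt], which turns contour integrals into means over the
    parameter. *)
Lemma circle_integral (rho : R) (f : C -> C) (v : C) :
  is_CRInt (fun t => f (circ rho t) * circ rho t)%C 0 1 v ->
  cycle_integral f (circle rho) = (2 * PI * Ci * v)%C.
Proof.
  intros H.
  change (1 * path_integral f (circle_path rho) + 0 = 2 * PI * Ci * v)%C.
  rewrite Cmult_1_l, Cplus_0_r.
  apply (is_RInt_unique (V := C_R_CompleteNormedModule)).
  generalize (is_CRInt_scal (2 * PI * Ci)%C _ _ _ _ H).
  apply (is_RInt_ext (V := C_R_NormedModule)); intros t Ht.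
  rewrite Rmin_left, Rmax_right in Ht by lra.
  change (path (circle_path rho)) with (circ rho).
  rewrite (path_derive_eq _ (circ rho) 0 1 t _ (fun s _ => eq_refl) Ht (circ_derive rho t)).
  match goal with |- ?a = ?b => change (@eq C a b) end; ring.
Qed.

Lemma two_PI_Ci_neq_0 : (2 * PI * Ci)%C <> 0%C.
Proof.
  intros E; apply (f_equal Cmod) in E.
  rewrite Cmod_0, !Cmod_mult, Cmod_Ci, !Cmod_R in E.
  pose proof PI_RGT_0; rewrite !Rabs_pos_eq in E by lra; lra.
Qed.

(* [1 / (y - w) - 1 / y] is the derivative of [log (1 - w / y)], a power series in [1 / y]. *)
Lemma winding_circle_inside (rho : R) (w : C) :
  Cmod w < rho -> winding (circle rho) w = 1%C.
Proof.
  intros Hw; pose proof (Cmod_ge_0 w) as Hw0.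
  assert (Hne : forall y, in_trace (circle rho) y -> y <> w /\ y <> 0%C).
  { intros y Hy; apply in_trace_circle in Hy; [|lra].
    split; intros ->; [lra|rewrite Cmod_0 in Hy; lra]. }
  (* A radius strictly between, so that [1 / y] lies strictly inside the disk of radius [1 / rho1],
     on which the geometric series of ratio [w / y] is controlled. Its sum [w / (1 - w / y)],
     multiplied by the derivative [- 1 / y^2] of [1 / y], is [1 / y - 1 / (y - w)]. *)
  set (rho1 := (Cmod w + rho) / 2).
  assert (Hr1 : Cmod w < rho1 < rho) by (unfold rho1; lra).
  assert (H1 : Cmod w * / rho1 <= 1).
  { apply Rmult_le_reg_r with rho1; [lra|]; rewrite Rmult_assoc, Rinv_l; lra. }
  assert (Hb := geom_coef_bound w w (/ rho1) ltac:(left; apply Rinv_0_lt_compat; lra) H1).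
  assert (E0 : cycle_integral (fun y => / (y - 0) + (- (1)) * / (y - w))%C (circle rho) = 0%C).
  { apply (cycle_integral_exact (fun y => psum (prim_coef (fun n => w * w ^ n)%C) (/ y))%C).
    - intros y Hy; destruct (Hne y Hy) as [Hyw Hy0].
      apply C_contE, C_continuous_plus; apply C_contE.
      + now apply C_cont_inv_sub.
      + apply C_cont_mult; [apply C_cont_const|now apply C_cont_inv_sub].
    - intros y Hy; destruct (Hne y Hy) as [Hyw Hy0]; apply in_trace_circle in Hy; [|lra].
      assert (Hiy : Cmod (/ y) < / rho1).
      { rewrite Cmod_inv, Hy by exact Hy0; apply Rinv_lt_contravar; nra. }
      destruct (psum_geom w w (/ y) (/ rho1) H1 Hiy) as [Hnz Eg].
      assert (Hyw' : (y - w)%C <> 0%C).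
      { intros E; apply Hyw; replace y with (y - w + w)%C by ring; rewrite E; ring. }
      replace (/ (y - 0) + - (1) * / (y - w))%C
        with (psum (fun n => w * w ^ n)%C (/ y) * (- / (y * y)))%C.
      + apply C_diff_comp; [exact (psum_primitive _ _ _ _ Hb Hiy)|now apply C_diff_inv].
      + rewrite Eg; field; repeat split; assumption. }
  rewrite cycle_integral_lin in E0.
  2:{ intros y Hy; now apply C_cont_inv_sub, Hne. }
  2:{ intros y Hy; now apply C_cont_inv_sub, Hne. }
  rewrite (circle_integral rho (fun y => / (y - 0))%C 1%C) in E0.
  2:{ assert (H : is_CRInt (fun _ => RtoC 1) 0 1 (scal (V := C_R_NormedModule) (1 - 0) (RtoC 1)))
        by apply is_RInt_const.
      rewrite scal_C_R in H; replace (RtoC (1 - 0) * 1)%C with (RtoC 1) in H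
        by (rewrite Rminus_0_r; ring).
      revert H; apply (is_RInt_ext (V := C_R_NormedModule)); intros t _.
      match goal with |- ?a = ?b => change (@eq C a b) end.
      field; replace (circ rho t - 0)%C with (circ rho t) by ring.
      apply Cmod_gt_0; rewrite Cmod_circ; lra. }
  unfold winding.
  replace (cycle_integral (fun y => / (y - w))%C (circle rho)) with (2 * PI * Ci * 1)%C.
  - rewrite Cmult_1_r; apply Cinv_l, two_PI_Ci_neq_0.
  - match type of E0 with (?a + ?b * ?c)%C = _ =>
      replace c with (a - (a + b * c))%C by ring; rewrite E0 end; ring.
Qed.

(** For [|y| < |w|] the function [1 / (y - w)] is a geometric series in [y], hence has a primitive
    on a disk containing the circle. *)
Lemma winding_circle_outside (rho : R) (w : C) :
  0 < rho < Cmod w -> winding (circle rho) w = 0%C.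
Proof.
  intros Hw.
  assert (Hw0 : w <> 0%C) by (apply Cmod_gt_0; lra).
  assert (H1 : Cmod (/ w) * Cmod w <= 1) by (rewrite Cmod_inv, Rinv_l by (trivial; lra); lra).
  assert (Hb := geom_coef_bound (- / w) (/ w) (Cmod w) ltac:(lra) H1).
  unfold winding.
  rewrite (cycle_integral_exact (psum (prim_coef (fun n => - / w * (/ w) ^ n)%C))); [ring| |].
  - intros y Hy; apply in_trace_circle in Hy; [|lra].
    apply C_cont_inv_sub; intros ->; lra.
  - intros y Hy; apply in_trace_circle in Hy; [|lra].
    destruct (psum_geom (- / w) (/ w) y (Cmod w) H1 ltac:(lra)) as [Hnz Eg].
    assert (Hyw : (y - w)%C <> 0%C).
    { intros E; assert (y = w) by (replace y with (y - w + w)%C by ring; rewrite E; ring).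
      subst y; lra. }
    replace (/ (y - w))%C with (psum (fun n => - / w * (/ w) ^ n)%C y).
    + apply (psum_primitive _ (Cmod w) (Cmod (- / w))); [exact Hb|lra].
    + rewrite Eg; field; repeat split; try assumption.
      intros E; apply Hyw; replace (y - w)%C with (- (w - y))%C by ring; rewrite E; ring.
Qed.

(** * Cauchy's formula and the power series expansion on a disk *)

Lemma is_Cseries_bounded (u : nat -> C) (l : C) :
  is_Cseries u l -> exists M, forall n, Cmod (u n) <= M.
Proof.
  intros H.
  destruct (filterlim_bounded (V := C_NormedModule) (sum_n u) (ex_intro _ l H)) as [M HM].
  change (forall n, Cmod (sum_n (G := C_AbelianMonoid) u n) <= M) in HM.
  exists (M + M); intros [|n].
  - pose proof (HM O) as H0; rewrite sum_O in H0.
    pose proof (Cmod_ge_0 (u O)); lra.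
  - pose proof (HM n) as H0; pose proof (HM (S n)) as H1.
    rewrite sum_Sn in H1.
    set (A := sum_n (G := C_AbelianMonoid) u n) in *.
    change (Cmod (A + u (S n))%C <= M) in H1.
    replace (u (S n)) with ((A + u (S n)) + - A)%C by ring.
    eapply Rle_trans; [apply Cmod_triangle|]; rewrite Cmod_opp; lra.
Qed.

(** Convergence at the single point [w + rho] bounds the terms there, which is already a coefficient
    bound at radius [rho]. *)
Lemma analytic_on_psum (Omega : C -> Prop) (f : C -> C) (w : C) :
  analytic_on Omega f -> Omega w ->
  exists a rho M, 0 < rho /\ coef_bound a rho M /\
    forall y, Cmod (y - w) < rho -> f y = psum a (y - w)%C.
Proof.
  intros Hf Hw; destruct (Hf w Hw) as (a & [d Hd]).
  assert (Hball : forall y : C, Cmod (y - w) < d ->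
    is_Cseries (fun n => a n * (y - w) ^ n)%C (f y)).
  { intros y Hy; apply is_pseries_Cseries, Hd, C_NormedModule_mixin_compat1, Hy. }
  pose proof (cond_pos d) as Hd0; set (rho := d / 2).
  assert (Hrho : 0 < rho < d) by (unfold rho; lra).
  assert (E : (w + RtoC rho - w)%C = RtoC rho) by ring.
  destruct (is_Cseries_bounded _ _ (Hball (w + RtoC rho)%C
    ltac:(rewrite E, Cmod_R, Rabs_pos_eq; lra))) as [M HM].
  exists a, rho, M; split; [lra|]; split.
  - intros n; specialize (HM n); cbv beta in HM.
    rewrite E, Cmod_mult, Cmod_pow, Cmod_R, Rabs_pos_eq in HM by lra; exact HM.
  - intros y Hy; symmetry; apply psum_eq, Hball; lra.
Qed.

(* The complex derivative, computed along the real direction so as to be total. *)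
Definition Cderiv (f : C -> C) (w : C) : C := path_derive (fun t => f (w + RtoC t)%C) 0.

Lemma Cderiv_eq (f : C -> C) (w l : C) : C_diff f w l -> Cderiv f w = l.
Proof.
  intros H.
  assert (Ht : is_Cderive (fun t => w + RtoC t)%C 0 (RtoC 1)).
  { apply is_CderiveE; intros eps He.
    exists (mkposreal 1 Rlt_0_1); intros s _.
    replace (w + RtoC s - (w + 0) - RtoC (s - 0) * 1)%C with (RtoC 0).
    - rewrite Cmod_0; apply Rmult_le_pos; [lra|apply Rabs_pos].
    - rewrite Rminus_0_r; ring. }
  replace l with (l * 1)%C by ring.
  apply (path_derive_eq _ (fun t => f (w + RtoC t)%C) (-1) 1); [reflexivity|lra|].
  apply is_Cderive_comp; [|exact Ht].
  replace (w + RtoC 0)%C with w by ring; exact H.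
Qed.

(** Halving the radius pays for the factor [n + 1], because [(n + 1) / 2^(n+1)] is bounded; the
    factor [2 / rho] restores the shift of the index. *)
Lemma psum_deriv_bound a rho M :
  0 < rho -> coef_bound a rho M ->
  exists M', coef_bound (fun n => RtoC (INR (S n)) * a (S n))%C (rho / 2) M'.
Proof.
  intros Hr Ha; pose proof (coef_bound_pos _ _ _ Ha) as HM.
  destruct (INR_mult_pow_bounded (/ 2) ltac:(lra)) as [K HK].
  exists (K * M * (2 / rho)); intros n.
  rewrite Cmod_mult, Cmod_R, Rabs_pos_eq by apply pos_INR.
  replace (INR (S n) * Cmod (a (S n)) * (rho / 2) ^ n)
    with (INR (S n) * (/ 2) ^ S n * (Cmod (a (S n)) * rho ^ S n) * (2 / rho)).
  - apply Rmult_le_compat_r; [left; apply Rdiv_lt_0_compat; lra|].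
    apply Rmult_le_compat; [| |apply HK|apply Ha].
    + apply Rmult_le_pos; [apply pos_INR|apply pow_le; lra].
    + apply Rmult_le_pos; [apply Cmod_ge_0|apply pow_le; lra].
  - unfold Rdiv; rewrite Rpow_mult_distr; simpl pow; field; lra.
Qed.

(** Around [w] the derivative at every nearby point is computed from the one expansion at [w], so
    [Cderiv f] is locally the termwise derivative and therefore continuous. This continuity is what
    differentiation under the integral sign asks for. *)
Lemma analytic_deriv (Omega : C -> Prop) (f : C -> C) (w : C) :
  analytic_on Omega f -> Omega w ->
  C_diff f w (Cderiv f w) /\ C_cont (Cderiv f) w.
Proof.
  intros Hf Hw; destruct (analytic_on_psum Omega f w Hf Hw) as (a & rho & M & Hr & Ha & E).
  assert (HD : forall y, Cmod (y - w) < rho ->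
    C_diff f y (psum (ddc a (y - w)) (y - w))%C).
  { intros y Hy.
    apply (C_diff_loc f (fun x => psum a (x - w))%C y _ (rho - Cmod (y - w))); [lra| |].
    - intros x Hx; apply E.
      replace (x - w)%C with ((x - y) + (y - w))%C by ring.
      eapply Rle_lt_trans; [apply Cmod_triangle|lra].
    - apply C_diff_translate; exact (psum_diff a rho M _ Ha Hy). }
  assert (Hww : Cmod (w - w) < rho).
  { replace (w - w)%C with (RtoC 0) by ring; rewrite Cmod_0; lra. }
  split; [rewrite (Cderiv_eq f w _ (HD w Hww)); exact (HD w Hww)|].
  destruct (psum_deriv_bound a rho M Hr Ha) as [M' Hb].
  apply (C_cont_loc _ (fun y => psum (fun n => RtoC (INR (S n)) * a (S n))%C (y - w)%C) w rho Hr).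
  - intros y Hy; rewrite (Cderiv_eq f y _ (HD y Hy)).
    symmetry; apply psum_eq; exact (psum_ddc_diag a rho M _ Ha Hy).
  - intros eps He.
    assert (H0 : Cmod 0 < rho / 2) by (rewrite Cmod_0; lra).
    destruct (psum_cont _ _ _ _ Hb H0 eps He) as (del & Hd & H).
    exists del; split; [exact Hd|]; intros y Hy.
    replace (w - w)%C with (RtoC 0) by ring; apply H.
    replace (y - w - 0)%C with (y - w)%C by ring; exact Hy.
Qed.

Lemma analytic_cont (Omega : C -> Prop) (f : C -> C) (w : C) :
  analytic_on Omega f -> Omega w -> C_cont f w.
Proof.
  intros Hf Hw; exact (C_diff_cont _ _ _ (proj1 (analytic_deriv _ _ _ Hf Hw))).
Qed.

(** Stated for real integrands; complex ones are treated through their real and imaginary parts. *)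
Lemma is_derive_RInt_param_continuous (Psi D : R -> R -> R) (s0 eta d : R) :
  0 < eta ->
  (forall s t, Rabs (s - s0) < eta -> is_derive (fun u => Psi u t) s (D s t)) ->
  (forall t, continuous (fun p : R * R => D (fst p) (snd p)) (s0, t)) ->
  (forall s t, Rabs (s - s0) < eta -> continuous (Psi s) t) ->
  is_RInt (D s0) 0 1 d ->
  is_derive (fun s => RInt (Psi s) 0 1) s0 d.
Proof.
  intros Heta Hd HD HP Hint.
  assert (Hloc : locally s0 (fun s => Rabs (s - s0) < eta)).
  { exists (mkposreal eta Heta); intros s Hs; exact Hs. }
  assert (H00 : Rabs (s0 - s0) < eta) by (rewrite Rminus_diag, Rabs_R0; exact Heta).
  replace d with (RInt (fun t => Derive (fun u => Psi u t) s0) 0 1).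
  2:{ rewrite <- (is_RInt_unique _ _ _ _ Hint); apply RInt_ext; intros t _.
      apply is_derive_unique, Hd, H00. }
  apply is_derive_RInt_param.
  - revert Hloc; apply filter_imp; intros s Hs t _; exists (D s t); now apply Hd.
  - intros t _.
    apply (continuity_2d_pt_ext_loc D).
    + exists (mkposreal eta Heta); intros s u Hs _; symmetry.
      apply is_derive_unique, Hd, Hs.
    + apply continuity_2d_pt_filterlim, HD.
  - revert Hloc; apply filter_imp; intros s Hs.
    apply (ex_RInt_continuous (V := R_CompleteNormedModule)); intros t _; now apply HP.
Qed.

Lemma C_continuous_RtoC {T : UniformSpace} (h : T -> R) (t : T) :
  continuous (U := R_UniformSpace) h t -> C_continuous (fun s => RtoC (h s)) t.
Proof.
  intros H; apply C_continuousE; intros eps He.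
  pose proof (proj1 (filterlim_locally (U := R_UniformSpace) h (h t)) H (mkposreal eps He)) as H'.
  revert H'; apply filter_imp; intros s Hs.
  change (Rabs (h s - h t) < eps) in Hs.
  rewrite <- RtoC_minus, Cmod_R; exact Hs.
Qed.

(** Cauchy's formula for the constant 1: the winding number, with [2 * PI * i] cancelled against the
    derivative of the parametrization. *)
Lemma circ_kernel_integral (rho : R) (w : C) :
  Cmod w < rho -> is_CRInt (fun t => circ rho t / (circ rho t - w))%C 0 1 (RtoC 1).
Proof.
  intros Hw; pose proof (Cmod_ge_0 w) as Hw0.
  pose proof (winding_circle_inside rho w Hw) as E; unfold winding in E.
  change (/ (2 * PI * Ci) * (1 * path_integral (fun y => / (y - w)) (circle_path rho) + 0) = 1)%C in E.
  rewrite Cmult_1_l, Cplus_0_r in E.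
  rewrite <- E.
  assert (H : is_CRInt (path_integrand (fun y => / (y - w))%C (circle_path rho)) 0 1
    (path_integral (fun y => / (y - w))%C (circle_path rho))).
  { apply path_integral_correct; intros t _; apply C_cont_inv_sub.
    intros Ec; pose proof (Cmod_circ rho t ltac:(lra)) as Hc.
    change (path (circle_path rho) t) with (circ rho t) in Ec; rewrite Ec in Hc; lra. }
  generalize (is_CRInt_scal (/ (2 * PI * Ci)) _ _ _ _ H).
  apply (is_RInt_ext (V := C_R_NormedModule)); intros t Ht.
  rewrite Rmin_left, Rmax_right in Ht by lra.
  unfold path_integrand; change (path (circle_path rho)) with (circ rho).
  rewrite (path_derive_eq _ (circ rho) 0 1 t _ (fun s _ => eq_refl) Ht (circ_derive rho t)).
  pose proof two_PI_Ci_neq_0 as Hn.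
  assert (Hy : (circ rho t - w)%C <> 0%C).
  { apply Cmod_gt_0; pose proof (Cmod_le_plus_sub (circ rho t) w) as H1.
    rewrite Cmod_circ in H1; lra. }
  match goal with |- ?a = ?b => change (@eq C a b) end.
  replace (/ (2 * PI * Ci) * (/ (circ rho t - w) * (2 * PI * Ci * circ rho t)))%C
    with (/ (2 * PI * Ci) * (2 * PI * Ci) * (circ rho t / (circ rho t - w)))%C
    by (unfold Cdiv; ring).
  rewrite Cinv_l by exact Hn; ring.
Qed.

Lemma C_continuous_kernel (rho : R) (w : C) (t : R) :
  Cmod w < rho -> C_continuous (fun t => circ rho t / (circ rho t - w))%C t.
Proof.
  intros Hw; pose proof (Cmod_ge_0 w).
  apply C_continuous_mult; [apply circ_continuous|].
  apply (C_cont_comp (fun y => / (y - w))%C); [|apply circ_continuous].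
  apply C_cont_inv_sub; intros E.
  pose proof (Cmod_circ rho t ltac:(lra)) as Hc; rewrite E in Hc; lra.
Qed.

(* Deformation of the circle to the point [w]: with [y = circ rho t], the derivative of
   [s |-> int_0^1 f (w + s (y - w)) * (y / (y - w)) dt] is
   [int_0^1 f' (w + s (y - w)) * y dt], whose integrand is a [t]-derivative for [s <> 0]. *)
Lemma cauchy_formula (Rad rho : R) (f : C -> C) (w : C) :
  analytic_on (disk Rad) f -> rho < Rad -> Cmod w < rho ->
  is_CRInt (fun t => f (circ rho t) * (circ rho t / (circ rho t - w)))%C 0 1 (f w).
Proof.
  intros Hf HR Hw; pose proof (Cmod_ge_0 w) as Hw0.
  set (k := fun t => (circ rho t / (circ rho t - w))%C).
  set (y := circ rho).
  assert (Hy : forall t, Cmod (y t) = rho) by (intros t; apply Cmod_circ; lra).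
  assert (Hyw : forall t, (y t - w)%C <> 0%C).
  { intros t; apply Cmod_gt_0; pose proof (Cmod_le_plus_sub (y t) w) as H1.
    rewrite Hy in H1; lra. }
  set (pt := fun s t => (w + RtoC s * (y t - w))%C).
  (* For [s0] in [[0, 1]] the point [pt s0 t] has modulus at most [rho], and [|y - w| <= 2 * rho]; a
     change of [s] by less than [eta] moves it by less than [Rad - rho], so it stays in the disk. *)
  set (eta := (Rad - rho) / (2 * rho)).
  assert (Heta : 0 < eta) by (apply Rdiv_lt_0_compat; lra).
  assert (Hpt : forall s0 s t, 0 <= s0 <= 1 -> Rabs (s - s0) < eta -> Cmod (pt s t) < Rad).
  { intros s0 s t Hs0 Hs.
    replace (pt s t) with (RtoC (1 - s0) * w + (RtoC s0 * y t + RtoC (s - s0) * (y t - w)))%C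
      by (unfold pt; rewrite !RtoC_minus; ring).
    eapply Rle_lt_trans; [apply Cmod_triangle|].
    eapply Rle_lt_trans; [apply Rplus_le_compat_l, Cmod_triangle|].
    rewrite !Cmod_mult, !Cmod_R, Hy, !(Rabs_pos_eq (1 - s0)), (Rabs_pos_eq s0) by lra.
    assert (H1 : Cmod (y t - w) <= 2 * rho).
    { eapply Rle_trans; [apply Cmod_triangle|]; rewrite Cmod_opp, Hy; lra. }
    assert (H2 : Rabs (s - s0) * Cmod (y t - w) <= Rabs (s - s0) * (2 * rho))
      by (apply Rmult_le_compat_l; [apply Rabs_pos|exact H1]).
    assert (H3 : Rabs (s - s0) * (2 * rho) < eta * (2 * rho))
      by (apply Rmult_lt_compat_r; lra).
    replace (eta * (2 * rho)) with (Rad - rho) in H3 by (unfold eta; field; lra).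
    assert ((1 - s0) * Cmod w <= (1 - s0) * rho) by (apply Rmult_le_compat_l; lra).
    lra. }
  set (Psi := fun s t => (f (pt s t) * k t)%C).
  set (D := fun s t => (Cderiv f (pt s t) * y t)%C).
  assert (Hk : forall t, C_continuous k t) by (intros t; apply C_continuous_kernel; exact Hw).
  assert (Hyc : forall t, C_continuous y t) by (intros t; apply circ_continuous).
  assert (Hpc : forall s t, C_continuous (pt s) t).
  { intros s t; apply C_continuous_plus; [apply continuous_const|].
    apply C_continuous_mult; [apply continuous_const|].
    apply C_continuous_plus; [apply Hyc|apply continuous_const]. }
  assert (HPc : forall s0 s t, 0 <= s0 <= 1 -> Rabs (s - s0) < eta -> C_continuous (Psi s) t).
  { intros s0 s t Hs0 Hs; apply C_continuous_mult; [|apply Hk].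
    apply C_cont_comp; [|apply Hpc].
    apply (analytic_cont (disk Rad)); [exact Hf|exact (Hpt s0 s t Hs0 Hs)]. }
  assert (HPd : forall s0 s t, 0 <= s0 <= 1 -> Rabs (s - s0) < eta ->
    is_Cderive (fun u => Psi u t) s (D s t)).
  { intros s0 s t Hs0 Hs.
    assert (Hlin : is_Cderive (fun u => pt u t) s (y t - w)%C).
    { apply is_CderiveE; intros eps He; exists (mkposreal 1 Rlt_0_1); intros u _.
      replace (pt u t - pt s t - RtoC (u - s) * (y t - w))%C with (RtoC 0)
        by (unfold pt; rewrite RtoC_minus; ring).
      rewrite Cmod_0; apply Rmult_le_pos; [lra|apply Rabs_pos]. }
    pose proof (proj1 (analytic_deriv _ f (pt s t) Hf (Hpt s0 s t Hs0 Hs))) as Hdf.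
    replace (D s t) with (k t * (Cderiv f (pt s t) * (y t - w)))%C
      by (unfold D, k; fold y; field; apply Hyw).
    apply (is_derive_ext (V := C_R_NormedModule) (fun u => (k t * f (pt u t))%C)).
    { intros u; apply Cmult_comm. }
    apply (is_Cderive_comp (fun x => k t * x)%C (fun u => f (pt u t))).
    - pose proof (C_diff_scal (k t) _ (f (pt s t)) _ (C_diff_id _)) as H1.
      rewrite Cmult_1_r in H1; exact H1.
    - apply (is_Cderive_comp f (fun u => pt u t)); [exact Hdf|exact Hlin]. }
  assert (HDc : forall s t, 0 <= s <= 1 ->
    C_continuous (fun p : R * R => D (fst p) (snd p)) (s, t)).
  { intros s t Hs.
    assert (Hy2 : C_continuous (fun p : R * R => y (snd p)) (s, t)).
    { apply (continuous_comp (fun p : R * R => snd p) y); [apply continuous_snd|apply Hyc]. }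
    apply C_continuous_mult; [|exact Hy2].
    apply (C_cont_comp (Cderiv f) (fun p : R * R => pt (fst p) (snd p))).
    - apply (analytic_deriv (disk Rad) f _ Hf); apply (Hpt s s t Hs).
      rewrite Rminus_diag, Rabs_R0; exact Heta.
    - apply C_continuous_plus; [apply continuous_const|].
      apply C_continuous_mult.
      + apply C_continuous_RtoC, continuous_fst.
      + apply C_continuous_plus; [exact Hy2|apply continuous_const]. }
  assert (HDc1 : forall s t, 0 <= s <= 1 -> C_continuous (D s) t).
  { intros s t Hs.
    apply (continuous_comp_2 (fun _ => s) (fun t => t) D t);
      [apply continuous_const|apply continuous_id|exact (HDc s t Hs)]. }
  assert (Hexd : forall s, 0 <= s <= 1 -> exists d : C, is_CRInt (D s) 0 1 d).
  { intros s Hs; apply (ex_RInt_continuous (V := C_R_CompleteNormedModule)).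
    intros t _; now apply HDc1. }
  (* Up to the nonzero factor [2 * PI * i * s], [D s] is the derivative of [f (pt s t)] in [t], and
     [pt s] is a closed curve. *)
  assert (HD0 : forall s, 0 < s <= 1 -> is_CRInt (D s) 0 1 (RtoC 0)).
  { intros s Hs.
    assert (Hc : (2 * PI * Ci * RtoC s)%C <> 0%C).
    { apply Cmult_neq_0; [apply two_PI_Ci_neq_0|].
      intros E; apply RtoC_inj in E; lra. }
    assert (Hprim : is_CRInt (fun t => Cderiv f (pt s t) * (RtoC s * (2 * PI * Ci * y t)))%C 0 1
      (minus (G := C_R_NormedModule) (f (pt s 1)) (f (pt s 0)))).
    { apply (is_RInt_derive (V := C_R_CompleteNormedModule) (fun t => f (pt s t))).
      - intros t _; apply (is_Cderive_comp f (pt s)).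
        + apply (analytic_deriv (disk Rad)); [exact Hf|].
          apply (Hpt s s t); [lra|rewrite Rminus_diag, Rabs_R0; exact Heta].
        + apply (is_Cderive_comp (fun x => w + RtoC s * (x - w))%C y); [|apply circ_derive].
          intros eps He; exists 1; split; [lra|]; intros x _.
          replace (w + s * (x - w) - (w + s * (y t - w)) - (x - y t) * s)%C
            with (RtoC 0) by ring.
          rewrite Cmod_0; apply Rmult_le_pos; [lra|apply Cmod_ge_0].
      - intros t _.
        apply (continuous_ext (U := C_UniformSpace) (fun t => (2 * PI * Ci * RtoC s) * D s t)%C).
        + intros u; unfold D; match goal with |- ?a = ?b => change (@eq C a b) end; ring.
        + apply C_continuous_mult; [apply continuous_const|apply HDc1; lra]. }
    replace (minus (G := C_R_NormedModule) (f (pt s 1)) (f (pt s 0))) with (RtoC 0) in Hprim.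
    2:{ unfold pt, y; rewrite (circ_closed rho).
        match goal with |- _ = minus ?a ?b => change (RtoC 0 = a - b)%C end; ring. }
    pose proof (is_CRInt_scal (/ (2 * PI * Ci * RtoC s)) _ _ _ _ Hprim) as H.
    rewrite Cmult_0_r in H.
    revert H; apply (is_RInt_ext (V := C_R_NormedModule)); intros t _.
    match goal with |- ?a = ?b => change (@eq C a b) end.
    unfold D.
    replace (/ (2 * PI * Ci * RtoC s) * (Cderiv f (pt s t) * (RtoC s * (2 * PI * Ci * y t))))%C
      with ((/ (2 * PI * Ci * RtoC s) * (2 * PI * Ci * RtoC s)) * (Cderiv f (pt s t) * y t))%C by ring.
    rewrite Cinv_l by exact Hc; ring. }
  (* [proj] stands for the real or the imaginary part, so that one argument serves both. *)
  assert (Hpart : forall proj : C -> R,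
    (forall (T : UniformSpace) (h : T -> C) t, C_continuous h t ->
       continuous (U := R_UniformSpace) (fun u => proj (h u)) t) ->
    (forall (h : R -> C) t v, is_Cderive h t v -> is_derive (fun u => proj (h u)) t (proj v)) ->
    (forall (h : R -> C) a b v, is_CRInt h a b v -> is_RInt (fun u => proj (h u)) a b (proj v)) ->
    proj (RtoC 0) = 0 ->
    RInt (fun t => proj (Psi 0 t)) 0 1 = RInt (fun t => proj (Psi 1 t)) 0 1).
  { intros proj Pc Pd Pi P0.
    set (phi := fun s => RInt (fun t => proj (Psi s t)) 0 1).
    assert (Hphi : forall s d, 0 <= s <= 1 -> is_CRInt (D s) 0 1 d -> is_derive phi s (proj d)).
    { intros s d Hs Hd.
      apply (is_derive_RInt_param_continuous (fun s t => proj (Psi s t))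
        (fun s t => proj (D s t)) s eta); [exact Heta| | | |].
      - intros u t Hu; apply (Pd (fun u => Psi u t)); exact (HPd s u t Hs Hu).
      - intros t; apply (Pc _ (fun p : R * R => D (fst p) (snd p))); now apply HDc.
      - intros u t Hu; apply (Pc _ (Psi u)); exact (HPc s u t Hs Hu).
      - now apply Pi. }
    (* The derivative is known to vanish only for [s > 0]; at [s = 0] it merely exists, which gives
       the continuity that the mean value theorem requires there. *)
    destruct (MVT_gen phi 0 1 (fun _ => 0)) as (c & _ & Hc).
    - rewrite Rmin_left, Rmax_right by lra; intros s Hs.
      rewrite <- P0; apply Hphi; [lra|apply HD0; lra].
    - rewrite Rmin_left, Rmax_right by lra; intros s Hs.
      destruct (Hexd s Hs) as [d Hd].
      apply continuity_pt_filterlim, (ex_derive_continuous phi); exists (proj d); now apply Hphi.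
    - change (phi 0 = phi 1); lra. }
  assert (Hex : forall s, 0 <= s <= 1 -> exists v : C, is_CRInt (Psi s) 0 1 v).
  { intros s Hs; apply (ex_RInt_continuous (V := C_R_CompleteNormedModule)).
    intros t _; apply (HPc s s t Hs); rewrite Rminus_diag, Rabs_R0; exact Heta. }
  destruct (Hex 0 ltac:(lra)) as [v0 Hv0]; destruct (Hex 1 ltac:(lra)) as [v1 Hv1].
  assert (Ev : v0 = v1).
  { apply injective_projections.
    - pose proof (is_RInt_unique _ _ _ _ (is_RInt_fct_extend_fst (U := R_NormedModule) (V := R_NormedModule) _ _ _ _ Hv0)) as A0.
      pose proof (is_RInt_unique _ _ _ _ (is_RInt_fct_extend_fst (U := R_NormedModule) (V := R_NormedModule) _ _ _ _ Hv1)) as A1.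
      refine (eq_trans (eq_sym A0) (eq_trans (Hpart fst _ _ _ _) A1)).
      + intros T h t; apply C_continuous_fst.
      + intros h t v; apply is_Cderive_fst.
      + intros h a b v; apply (is_RInt_fct_extend_fst (U := R_NormedModule) (V := R_NormedModule)).
      + reflexivity.
    - pose proof (is_RInt_unique _ _ _ _ (is_RInt_fct_extend_snd (U := R_NormedModule) (V := R_NormedModule) _ _ _ _ Hv0)) as A0.
      pose proof (is_RInt_unique _ _ _ _ (is_RInt_fct_extend_snd (U := R_NormedModule) (V := R_NormedModule) _ _ _ _ Hv1)) as A1.
      refine (eq_trans (eq_sym A0) (eq_trans (Hpart snd _ _ _ _) A1)).
      + intros T h t; apply C_continuous_snd.
      + intros h t v; apply is_Cderive_snd.
      + intros h a b v; apply (is_RInt_fct_extend_snd (U := R_NormedModule) (V := R_NormedModule)).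
      + reflexivity. }
  (* At [s = 0] the curve is the point [w] and the integral is [f w] times that of the kernel; at
     [s = 1] it is the integral wanted. *)
  assert (E0 : v0 = f w).
  { apply (is_CRInt_unique (Psi 0) 0 1); [exact Hv0|].
    pose proof (is_CRInt_scal (f w) _ _ _ _ (circ_kernel_integral rho w Hw)) as H.
    rewrite Cmult_1_r in H.
    revert H; apply (is_RInt_ext (V := C_R_NormedModule)); intros t _.
    match goal with |- ?a = ?b => change (@eq C a b) end.
    unfold Psi, pt; replace (w + 0 * (y t - w))%C with w by ring; reflexivity. }
  rewrite <- E0, Ev.
  revert Hv1; apply (is_RInt_ext (V := C_R_NormedModule)); intros t _.
  match goal with |- ?a = ?b => change (@eq C a b) end.
  unfold Psi, pt; replace (w + 1 * (y t - w))%C with (y t) by ring; reflexivity.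
Qed.

Lemma Cseries_remainder (u : nat -> C) (l : C) (b : nat -> R) :
  (forall n, Cmod (sum_n (G := C_AbelianMonoid) u n - l) <= b n) ->
  is_lim_seq b 0 -> is_Cseries u l.
Proof.
  intros Hb Hlim; unfold is_series.
  apply (proj2 (filterlim_locally_ball_norm (U := C_NormedModule) (sum_n u) l)).
  intros eps.
  pose proof (proj1 (filterlim_locally (U := R_UniformSpace) b 0) Hlim eps) as H.
  revert H; apply filter_imp; intros n Hn.
  change (Rabs (b n - 0) < eps) in Hn.
  change (Cmod (sum_n (G := C_AbelianMonoid) u n - l) < eps).
  specialize (Hb n); pose proof (Rle_abs (b n - 0)); lra.
Qed.

(** The coefficients are the means of [f y / y^n] over the circle, so a bound of [f] on the circle
    bounds them. Series and integral are never exchanged: the kernel is expanded finitely, with an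
    explicit remainder [w^(n+1) * rem (n + 1)]. *)
Lemma cauchy_psum (Rad rho : R) (f : C -> C) :
  analytic_on (disk Rad) f -> 0 < rho < Rad ->
  exists a M, coef_bound a rho M /\ forall w, Cmod w < rho -> f w = psum a w.
Proof.
  intros Hf Hr.
  set (y := circ rho).
  assert (Hy : forall t, Cmod (y t) = rho) by (intros t; apply Cmod_circ; lra).
  assert (Hy0 : forall t, y t <> 0%C) by (intros t; apply Cmod_gt_0; rewrite Hy; lra).
  assert (Hyc : forall t, C_continuous y t) by (intros t; apply circ_continuous).
  assert (Hfc : forall t, C_continuous (fun t => f (y t)) t).
  { intros t; apply C_cont_comp; [|apply Hyc].
    apply (analytic_cont (disk Rad)); [exact Hf|]; unfold disk; rewrite Hy; lra. }
  assert (Hic : forall n t, C_continuous (fun t => / y t ^ n)%C t).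
  { induction n as [|n IH]; intros t; [apply continuous_const|].
    apply (continuous_ext (U := C_UniformSpace) (fun t => / (y t - 0) * / y t ^ n)%C).
    { intros s; pose proof (Hy0 s); pose proof (Cpow_nz _ n (Hy0 s)).
      match goal with |- ?a = ?b => change (@eq C a b) end.
      simpl; field; split; assumption. }
    apply C_continuous_mult; [|apply IH].
    apply (C_cont_comp (fun x => / (x - 0))%C); [apply C_cont_inv_sub, Hy0|apply Hyc]. }
  assert (Hbound : forall (g : R -> C) , (forall t, C_continuous g t) -> exists K, 0 <= K /\
    forall n, exists v : C, is_CRInt (fun t => g t * / y t ^ n)%C 0 1 v /\ Cmod v * rho ^ n <= K).
  { intros g Hg.
    destruct (bounded_continuity (V := C_R_NormedModule) g 0 1 (fun t _ => Hg t)) as [K HK].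
    assert (HK' : forall t, 0 <= t <= 1 -> Cmod (g t) < K).
    { intros t Ht; specialize (HK t Ht); rewrite norm_C_R in HK; exact HK. }
    exists K; split.
    { pose proof (HK' 0 ltac:(lra)); pose proof (Cmod_ge_0 (g 0)); lra. }
    intros n.
    destruct (ex_RInt_continuous (V := C_R_CompleteNormedModule) (fun t => g t * / y t ^ n)%C 0 1)
      as [v Hv].
    { intros t _; apply C_continuous_mult; [apply Hg|apply Hic]. }
    exists v; split; [exact Hv|].
    assert (Hp : 0 < rho ^ n) by (apply pow_lt; lra).
    pose proof (norm_RInt_le_const (V := C_R_NormedModule)
      (fun t => g t * / y t ^ n)%C 0 1 v (K / rho ^ n) Rle_0_1) as Hn.
    rewrite norm_C_R in Hn.
    assert (H : Cmod v <= (1 - 0) * (K / rho ^ n)).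
    { apply Hn; [|exact Hv]; intros t Ht; rewrite norm_C_R, Cmod_mult.
      rewrite Cmod_inv, Cmod_pow, Hy by (apply Cpow_nz, Hy0).
      apply Rmult_le_compat_r; [left; now apply Rinv_0_lt_compat|].
      left; now apply HK'. }
    apply Rmult_le_compat_r with (r := rho ^ n) in H; [|lra].
    replace ((1 - 0) * (K / rho ^ n) * rho ^ n) with K in H by (field; lra); exact H. }
  assert (Hint : forall (g : R -> C) K,
    (forall n, exists v : C, is_CRInt (fun t => g t * / y t ^ n)%C 0 1 v /\ Cmod v * rho ^ n <= K) ->
    forall n, is_CRInt (fun t => g t * / y t ^ n)%C 0 1
       (RInt (V := C_R_CompleteNormedModule) (fun t => g t * / y t ^ n)%C 0 1) /\
      Cmod (RInt (V := C_R_CompleteNormedModule) (fun t => g t * / y t ^ n)%C 0 1) * rho ^ n <= K).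
  { intros g K H n; destruct (H n) as (v & Hv & HvK).
    rewrite (is_RInt_unique (V := C_R_CompleteNormedModule) _ _ _ _ Hv); now split. }
  destruct (Hbound _ Hfc) as (M & _ & HM).
  pose proof (Hint _ _ HM) as Ha; clear HM.
  set (a := fun n => RInt (V := C_R_CompleteNormedModule) (fun t => f (y t) * / y t ^ n)%C 0 1).
  exists a, M; split; [intros n; apply Ha|].
  intros w Hw; symmetry; apply psum_eq; pose proof (Cmod_ge_0 w) as Hw0.
  assert (Hyw : forall t, (y t - w)%C <> 0%C).
  { intros t; apply Cmod_gt_0; pose proof (Cmod_le_plus_sub (y t) w) as H1.
    rewrite Hy in H1; lra. }
  set (g := fun t => (f (y t) * (y t / (y t - w)))%C).
  destruct (Hbound g) as (K & HK0 & HK).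
  { intros t; apply C_continuous_mult; [apply Hfc|now apply C_continuous_kernel]. }
  pose proof (Hint _ _ HK) as Hrem; clear HK.
  set (rem := fun n => RInt (V := C_R_CompleteNormedModule) (fun t => g t * / y t ^ n)%C 0 1).
  assert (Hrem0 : rem O = f w).
  { apply (is_CRInt_unique (fun t => g t * / y t ^ 0)%C 0 1); [apply Hrem|].
    generalize (cauchy_formula Rad rho f w Hf ltac:(lra) Hw).
    apply (is_RInt_ext (V := C_R_NormedModule)); intros t _.
    match goal with |- ?a = ?b => change (@eq C a b) end.
    unfold g; fold y; simpl; field; apply Hyw. }
  (* From [y / (y - w) = 1 + w / (y - w)]. *)
  assert (Hrec : forall n, rem n = (a n + w * rem (S n))%C).
  { intros n; apply (is_CRInt_unique (fun t => g t * / y t ^ n)%C 0 1); [apply Hrem|].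
    generalize (is_CRInt_lin w _ _ _ _ _ _ (proj1 (Ha n)) (proj1 (Hrem (S n)))).
    apply (is_RInt_ext (V := C_R_NormedModule)); intros t _.
    match goal with |- ?a = ?b => change (@eq C a b) end.
    unfold g; rewrite Cpow_S; field; repeat split; first [apply Hyw|apply Cpow_nz, Hy0|apply Hy0]. }
  assert (Hsum : forall n, sum_n (G := C_AbelianMonoid) (fun n => a n * w ^ n)%C n =
    (f w - w ^ S n * rem (S n))%C).
  { induction n as [|n IH].
    - rewrite sum_O, <- Hrem0, (Hrec O); simpl; ring.
    - rewrite sum_Sn, IH.
      change ((f w - w ^ S n * rem (S n) + a (S n) * w ^ S n)%C =
              (f w - w * w ^ S n * rem (S (S n)))%C).
      rewrite (Hrec (S n)); ring. }
  apply (Cseries_remainder _ _ (fun n => K * (Cmod w / rho) ^ S n)).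
  - intros n; rewrite Hsum.
    replace (f w - w ^ S n * rem (S n) - f w)%C with (- (w ^ S n * rem (S n)))%C by ring.
    rewrite Cmod_opp, Cmod_mult, Cmod_pow.
    replace (Cmod w ^ S n * Cmod (rem (S n)))
      with (Cmod (rem (S n)) * rho ^ S n * (Cmod w / rho) ^ S n).
    + apply Rmult_le_compat_r; [apply pow_le, Rdiv_le_0_compat; lra|apply Hrem].
    + rewrite Rmult_assoc, <- Rpow_mult_distr, Rmult_comm; f_equal; f_equal; field; lra.
  - replace (Finite 0) with (Rbar_mult K (Finite 0)) by (simpl; f_equal; ring).
    apply is_lim_seq_scal_l, (is_lim_seq_incr_1 (fun n => (Cmod w / rho) ^ n)).
    apply is_lim_seq_geom, geom_ratio_lt; lra.
Qed.

(** Each radius comes with its own expansion; all those of radius at least [Rad / 2] agree on the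
    disk of radius [Rad / 2], hence have the same coefficients. Smaller radii inherit the bound. *)
Theorem analytic_disk_psum (Rad : R) (f : C -> C) :
  0 < Rad -> analytic_on (disk Rad) f ->
  exists a, (forall rho, 0 < rho < Rad -> exists M, coef_bound a rho M) /\
    forall w, Cmod w < Rad -> f w = psum a w.
Proof.
  intros HR Hf.
  destruct (cauchy_psum Rad (Rad / 2) f Hf ltac:(lra)) as (a & M0 & Ha & Ea).
  assert (H : forall rho, Rad / 2 <= rho < Rad ->
    exists M, coef_bound a rho M /\ forall w, Cmod w < rho -> f w = psum a w).
  { intros rho Hr; destruct (cauchy_psum Rad rho f Hf ltac:(lra)) as (b & M & Hb & Eb).
    assert (E : b = a).
    { apply functional_extensionality; intros n.
      apply (psum_coef_unique b a (Rad / 2) M M0); [lra| |exact Ha|].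
      - apply (coef_bound_weaken b rho); [lra|exact Hb].
      - intros y Hy; rewrite <- Ea, <- Eb by lra; reflexivity. }
    subst b; now exists M. }
  exists a; split.
  - intros rho Hr; destruct (H (Rmax rho (Rad / 2))) as (M & HM & _).
    { split; [apply Rmax_r|apply Rmax_lub_lt; lra]. }
    exists M; apply (coef_bound_weaken a (Rmax rho (Rad / 2))); [|exact HM].
    split; [lra|apply Rmax_l].
  - intros w Hw; pose proof (Cmod_ge_0 w).
    destruct (H (Rmax ((Cmod w + Rad) / 2) (Rad / 2))) as (M & _ & E).
    { split; [apply Rmax_r|apply Rmax_lub_lt; lra]. }
    apply E; eapply Rlt_le_trans; [|apply Rmax_l]; lra.
Qed.

(** * Divided differences as residue integrals *)

(** A bound at [Rad] itself may fail. Quantifying over all smaller radii gives a class stable under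
    divided differences at any node of the open disk. *)
Definition coef_bound_below (Rad : R) (a : nat -> C) : Prop :=
  forall rho, 0 < rho < Rad -> exists M, coef_bound a rho M.

Lemma ddc_bound_below Rad a z :
  Cmod z < Rad -> coef_bound_below Rad a -> coef_bound_below Rad (ddc a z).
Proof.
  intros Hz Ha rho Hr; pose proof (Cmod_ge_0 z).
  set (rho' := Rmax rho ((Cmod z + Rad) / 2)).
  pose proof (Rmax_l rho ((Cmod z + Rad) / 2)) as H1; fold rho' in H1.
  pose proof (Rmax_r rho ((Cmod z + Rad) / 2)) as H2; fold rho' in H2.
  assert (H3 : rho' < Rad) by (apply Rmax_lub_lt; lra).
  destruct (Ha rho' ltac:(lra)) as [M HM].
  eexists; apply (coef_bound_weaken _ rho'); [lra|].
  apply ddc_bound; [exact HM|lra].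
Qed.

Lemma coef_bound_below_at Rad a y :
  Cmod y < Rad -> coef_bound_below Rad a ->
  exists rho M, Cmod y < rho /\ coef_bound a rho M.
Proof.
  intros Hy Ha; pose proof (Cmod_ge_0 y).
  destruct (Ha ((Cmod y + Rad) / 2) ltac:(lra)) as [M HM].
  exists ((Cmod y + Rad) / 2), M; split; [lra|exact HM].
Qed.

Lemma psum_ddc_below Rad a y z :
  coef_bound_below Rad a -> Cmod y < Rad -> Cmod z < Rad ->
  psum a y = (psum a z + (y - z) * psum (ddc a z) y)%C.
Proof.
  intros Ha Hy Hz; pose proof (Cmod_ge_0 y); pose proof (Cmod_ge_0 z).
  set (rho := (Rmax (Cmod y) (Cmod z) + Rad) / 2).
  pose proof (Rmax_l (Cmod y) (Cmod z)); pose proof (Rmax_r (Cmod y) (Cmod z)).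
  assert (Rmax (Cmod y) (Cmod z) < Rad) by (apply Rmax_lub_lt; lra).
  destruct (Ha rho ltac:(unfold rho; lra)) as [M HM].
  apply (psum_ddc a rho M); trivial; unfold rho; lra.
Qed.

Lemma psum_cont_below Rad a y : coef_bound_below Rad a -> Cmod y < Rad -> C_cont (psum a) y.
Proof.
  intros Ha Hy; destruct (coef_bound_below_at Rad a y Hy Ha) as (rho & M & H1 & H2).
  exact (psum_cont a rho M y H2 H1).
Qed.

(** Cauchy's theorem on a disk: the primitive series converges on all of it. *)
Lemma psum_cycle_integral Rad a gamma :
  coef_bound_below Rad a -> (forall w, in_trace gamma w -> Cmod w < Rad) ->
  cycle_integral (psum a) gamma = 0%C.
Proof.
  intros Ha Hg; apply (cycle_integral_exact (psum (prim_coef a))).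
  - intros w Hw; apply (psum_cont_below Rad); auto.
  - intros w Hw; destruct (coef_bound_below_at Rad a w (Hg w Hw) Ha) as (rho & M & H1 & H2).
    exact (psum_primitive a rho M w H2 H1).
Qed.

(** * Integrals of reciprocals of node products *)

Definition Lprod (l : list C) (y : C) : C := fold_right (fun w p => (y - w) * p)%C 1%C l.

Lemma Lprod_app l1 l2 y : Lprod (l1 ++ l2) y = (Lprod l1 y * Lprod l2 y)%C.
Proof.
  induction l1 as [|w l IH]; simpl; [unfold Lprod; simpl; ring|].
  unfold Lprod in *; simpl; rewrite IH; ring.
Qed.

Lemma Lprod_neq_0 l y : ~ In y l -> Lprod l y <> 0%C.
Proof.
  induction l as [|w l IH]; intros H; unfold Lprod; simpl.
  - intros E; apply RtoC_inj in E; lra.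
  - apply Cmult_neq_0; [|apply IH; intros Hl; apply H; now right].
    intros E; apply H; left.
    replace y with (y - w + w)%C by ring; rewrite E; ring.
Qed.

Lemma Lprod_inv_cont l y : ~ In y l -> C_cont (fun y => / Lprod l y)%C y.
Proof.
  induction l as [|w l IH]; intros H.
  - exact (C_cont_const (/ 1)%C y).
  - assert (Hw : y <> w) by (intros ->; apply H; now left).
    assert (Hl : ~ In y l) by (intros Hl; apply H; now right).
    (* The list is finite, so a whole disk around [y] avoids the nodes and the reciprocal of the
       product factors on it. *)
    assert (Hmin : exists d, 0 < d /\ forall x, Cmod (x - y) < d -> ~ In x (w :: l)).
    { clear - H; induction (w :: l) as [|v k IHk].
      - exists 1; split; [lra|]; intros x _ [].
      - destruct IHk as (d & Hd & Hx); [intros Hk; apply H; now right|].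
        assert (Hv : 0 < Cmod (v - y)).
        { apply Cmod_gt_0; intros E; apply H; left.
          replace v with (v - y + y)%C by ring; rewrite E; ring. }
        exists (Rmin d (Cmod (v - y))); split; [now apply Rmin_pos|].
        pose proof (Rmin_l d (Cmod (v - y))); pose proof (Rmin_r d (Cmod (v - y))).
        intros x Hxy [<-|Hk]; [lra|]; apply (Hx x); [lra|exact Hk]. }
    destruct Hmin as (d & Hd & Hx).
    apply (C_cont_loc _ (fun y => / (y - w) * / Lprod l y)%C y d Hd).
    + intros x Hxy; specialize (Hx x Hxy).
      assert (H1 : Lprod l x <> 0%C) by (apply Lprod_neq_0; intros Hl'; apply Hx; now right).
      unfold Lprod; simpl; fold (Lprod l x).
      field; split; [exact H1|].
      intros E; apply Hx; left.
      replace x with (x - w + w)%C by ring; rewrite E; ring.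
    + apply C_cont_mult; [now apply C_cont_inv_sub|now apply IH].
Qed.

Lemma C_diff_pow (n : nat) (z : C) :
  C_diff (fun y => y ^ S n)%C z (RtoC (INR (S n)) * z ^ n)%C.
Proof.
  induction n as [|n IH].
  - replace (RtoC (INR 1) * z ^ 0)%C with (1 : C) by (simpl; ring).
    apply (C_diff_loc _ (fun y => y) z _ 1 Rlt_0_1); [|apply C_diff_id].
    intros y _; simpl; ring.
  - intros eps He.
    pose proof (Cmod_ge_0 z) as Hz.
    destruct (IH (eps / (2 * (Cmod z + 1)))) as (d1 & Hd1 & H1).
    { apply Rdiv_lt_0_compat; lra. }
    destruct (C_diff_cont _ _ _ IH (eps / 2) ltac:(lra)) as (d2 & Hd2 & H2).
    exists (Rmin d1 d2); split; [now apply Rmin_pos|]; intros y Hy.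
    pose proof (Rmin_l d1 d2); pose proof (Rmin_r d1 d2).
    specialize (H1 y ltac:(lra)); specialize (H2 y ltac:(lra)).
    rewrite (S_INR (S n)), RtoC_plus, !(Cpow_S _ (S n)).
    replace (y * y ^ S n - z * z ^ S n - (y - z) * ((INR (S n) + 1) * z ^ S n))%C
      with ((y - z) * (y ^ S n - z ^ S n) +
            z * (y ^ S n - z ^ S n - (y - z) * (INR (S n) * z ^ n)))%C
      by (rewrite !(Cpow_S z n); ring).
    eapply Rle_trans; [apply Cmod_triangle|]; rewrite !Cmod_mult.
    set (A := Cmod (y - z)) in *; assert (HA : 0 <= A) by apply Cmod_ge_0.
    assert (E1 : A * Cmod (y ^ S n - z ^ S n) <= A * (eps / 2))
      by (apply Rmult_le_compat_l; lra).
    assert (E2 : Cmod z * Cmod (y ^ S n - z ^ S n - (y - z) * (INR (S n) * z ^ n)) <= eps / 2 * A).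
    { apply Rle_trans with ((Cmod z + 1) * (eps / (2 * (Cmod z + 1)) * A)).
      - apply Rmult_le_compat; try apply Cmod_ge_0; [lra|exact H1].
      - right; field; lra. }
    lra.
Qed.

Definition residue_integral (gamma : cycle) (f : C -> C) : C :=
  (/ (2 * PI * Ci) * cycle_integral f gamma)%C.

(* Partial fractions at two distinct nodes turn the integral into a difference of two
   equal shorter ones; a power [(y - w)^(-n)] with [n >= 2] has a primitive. *)
Lemma residue_integral_inv_Lprod (gamma : cycle) (n : nat) : forall l : list C,
  length l = S n ->
  (forall w, In w l -> ~ in_trace gamma w /\ winding gamma w = 1%C) ->
  residue_integral gamma (fun y => / Lprod l y)%C = match n with O => 1%C | S _ => 0%C end.
Proof.
  assert (Hcont : forall l, (forall w, In w l -> ~ in_trace gamma w /\ winding gamma w = 1%C) ->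
    forall w, in_trace gamma w -> C_cont (fun y => / Lprod l y)%C w).
  { intros l Hl w Hw; apply Lprod_inv_cont; intros Hin; exact (proj1 (Hl w Hin) Hw). }
  induction n as [|n IH]; intros [|w l] Hlen Hl; try discriminate Hlen.
  - destruct l; [|discriminate Hlen].
    rewrite <- (proj2 (Hl w (or_introl eq_refl))).
    unfold residue_integral, winding; f_equal; apply cycle_integral_ext.
    intros y _; unfold Lprod; simpl; f_equal; ring.
  - assert (Hcase : (forall v, In v l -> v = w) \/ exists l1 v l2, l = l1 ++ v :: l2 /\ v <> w).
    { clear; induction l as [|v l IH]; [left; intros v []|].
      destruct (Ceq_dec v w) as [->|Hv].
      - destruct IH as [IH|(l1 & u & l2 & -> & Hu)].
        + left; intros u [<-|Hu]; [reflexivity|now apply IH].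
        + right; exists (w :: l1), u, l2; split; [reflexivity|exact Hu].
      - right; exists nil, v, l; split; [reflexivity|exact Hv]. }
    destruct Hcase as [Heq|(l1 & v & l2 & -> & Hv)].
    + assert (Hpow : forall y, Lprod (w :: l) y = ((y - w) ^ S (S n))%C).
      { intros y; rewrite <- Hlen.
        assert (Hall : forall u, In u (w :: l) -> u = w) by (intros u [<-|Hu]; auto).
        clear - Hall; induction (w :: l) as [|u k IHk]; [reflexivity|].
        unfold Lprod; simpl; rewrite (Hall u (or_introl eq_refl)); f_equal.
        apply IHk; intros x Hx; apply Hall; now right. }
      unfold residue_integral.
      rewrite (cycle_integral_exact
        (fun y => - / RtoC (INR (S n)) * (/ (y - w)) ^ S n)%C); [ring|now apply Hcont|].
      intros y Hy.
      assert (Hyw : y <> w) by (intros ->; apply (proj1 (Hl w (or_introl eq_refl))), Hy).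
      assert (Hyw' : (y - w)%C <> 0%C).
      { intros E; apply Hyw; replace y with (y - w + w)%C by ring; rewrite E; ring. }
      assert (HS : RtoC (INR (S n)) <> 0%C).
      { intros E; apply RtoC_inj in E; rewrite S_INR in E; pose proof (pos_INR n); lra. }
      replace (/ Lprod (w :: l) y)%C
        with (- / RtoC (INR (S n)) * (RtoC (INR (S n)) * (/ (y - w)) ^ n *
               - / ((y - w) * (y - w))))%C.
      * apply C_diff_scal.
        apply (C_diff_comp (fun x => x ^ S n)%C (fun y => / (y - w))%C);
          [apply C_diff_pow|now apply C_diff_inv_sub].
      * rewrite Hpow, !Cpow_S, Cpow_inv by exact Hyw'.
        field; repeat split; try assumption; now apply Cpow_nz.
    + assert (Hsub : forall u, In u (w :: l1 ++ l2) \/ In u (v :: l1 ++ l2) ->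
        ~ in_trace gamma u /\ winding gamma u = 1%C).
      { intros u Hu; apply Hl; simpl in *; rewrite !in_app_iff in *; simpl; tauto. }
      assert (Hlen' : length (l1 ++ l2) = n).
      { simpl in Hlen; rewrite length_app in *; simpl in Hlen; lia. }
      (* Both lists have [n + 1] nodes, so the induction gives them the same value, be it 1 or 0,
         and the difference vanishes. *)
      pose proof (IH (w :: l1 ++ l2) ltac:(simpl; lia) (fun u Hu => Hsub u (or_introl Hu))) as E1.
      pose proof (IH (v :: l1 ++ l2) ltac:(simpl; lia) (fun u Hu => Hsub u (or_intror Hu))) as E2.
      assert (Hwv : (w - v)%C <> 0%C).
      { intros E; apply Hv; replace w with (w - v + v)%C by ring; rewrite E; ring. }
      pose proof (Hcont _ (fun u Hu => Hsub u (or_introl Hu))) as C1.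
      pose proof (Hcont _ (fun u Hu => Hsub u (or_intror Hu))) as C2.
      assert (E : cycle_integral (fun y => / Lprod (w :: l1 ++ v :: l2) y)%C gamma =
        (/ (w - v) * (cycle_integral (fun y => / Lprod (w :: l1 ++ l2) y)%C gamma +
          - (1) * cycle_integral (fun y => / Lprod (v :: l1 ++ l2) y)%C gamma))%C).
      { rewrite <- (cycle_integral_lin (- (1))%C) by assumption.
        (* The leading 0 brings a scalar multiple into the form [f + c * h] covered by
           [cycle_integral_lin]. *)
        replace (cycle_integral (fun y => / Lprod (w :: l1 ++ v :: l2) y)%C gamma)
          with (cycle_integral (fun y => 0 + / (w - v) *
             (/ Lprod (w :: l1 ++ l2) y + - (1) * / Lprod (v :: l1 ++ l2) y))%C gamma).
        - rewrite cycle_integral_lin.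
          + rewrite (cycle_integral_exact (fun _ => RtoC 0) (fun _ => RtoC 0)).
            * ring.
            * intros; apply C_cont_const.
            * intros u _ eps He; exists 1; split; [lra|]; intros y _.
              replace (0 - 0 - (y - u) * 0)%C with (RtoC 0) by ring.
              rewrite Cmod_0; apply Rmult_le_pos; [lra|apply Cmod_ge_0].
          + intros; apply C_cont_const.
          + intros u Hu; apply C_contE, C_continuous_plus; apply C_contE; [now apply C1|].
            apply C_cont_mult; [apply C_cont_const|now apply C2].
        - apply cycle_integral_ext; intros y Hy.
          assert (Hn : ~ In y (w :: l1 ++ v :: l2)) by (intros Hin; exact (proj1 (Hl y Hin) Hy)).
          assert (N1 : Lprod l1 y <> 0%C).
          { apply Lprod_neq_0; intros Hin; apply Hn; right; apply in_app_iff; now left. }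
          assert (N2 : Lprod l2 y <> 0%C).
          { apply Lprod_neq_0; intros Hin; apply Hn; right; apply in_app_iff; right; now right. }
          assert (N3 : (y - w)%C <> 0%C).
          { intros E; apply Hn; left; replace y with (y - w + w)%C by ring; rewrite E; ring. }
          assert (N4 : (y - v)%C <> 0%C).
          { intros E; apply Hn; right; apply in_app_iff; right; left.
            replace y with (y - v + v)%C by ring; rewrite E; ring. }
          change (Lprod (w :: l1 ++ l2) y) with ((y - w) * Lprod (l1 ++ l2) y)%C.
          change (Lprod (v :: l1 ++ l2) y) with ((y - v) * Lprod (l1 ++ l2) y)%C.
          change (Lprod (w :: l1 ++ v :: l2) y) with ((y - w) * Lprod (l1 ++ v :: l2) y)%C.
          rewrite !Lprod_app; change (Lprod (v :: l2) y) with ((y - v) * Lprod l2 y)%C.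
          field; repeat split; assumption. }
      unfold residue_integral in *; rewrite E.
      match type of E1 with (?c * ?X)%C = _ =>
        match type of E2 with (_ * ?Y)%C = _ =>
          replace (c * (/ (w - v) * (X + - (1) * Y)))%C
            with (/ (w - v) * (c * X - c * Y))%C by ring
        end end.
      rewrite E1, E2; ring.
Qed.

(** Newton's divided difference of [psum a] at the nodes [w :: l]: the function is replaced by its
    difference quotient at each node in turn, and the last quotient is evaluated at the last node.
    Repeated nodes are allowed. *)
Fixpoint divided_difference (a : nat -> C) (w : C) (l : list C) : C :=
  match l with
  | nil => psum a w
  | v :: l' => divided_difference (ddc a w) v l'
  end.

(** Write [f y = f w + (y - w) * g y]. With at least two nodes the term [f w] integrates to 0 and
    [g] remains over one node fewer; with a single node [g] integrates to 0 and [f w] is left, the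
    winding number being 1. *)
Lemma residue_integral_divided_difference Rad gamma :
  (forall w, in_trace gamma w -> Cmod w < Rad) ->
  forall l w a, coef_bound_below Rad a ->
  (forall v, In v (w :: l) -> Cmod v < Rad /\ ~ in_trace gamma v /\ winding gamma v = 1%C) ->
  residue_integral gamma (fun y => psum a y * / Lprod (w :: l) y)%C =
  divided_difference a w l.
Proof.
  intros Hg; induction l as [|v l IH]; intros w a Ha Hl.
  - set (k := nil) in *.
    assert (E : cycle_integral (fun y => psum a y * / Lprod (w :: k) y)%C gamma =
      cycle_integral (fun y => psum (ddc a w) y + psum a w * / Lprod (w :: k) y)%C gamma).
    { apply cycle_integral_ext; intros y Hy.
      assert (N : (y - w)%C <> 0%C).
      { intros E; apply (proj1 (proj2 (Hl w (or_introl eq_refl)))).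
        replace w with (w + 0)%C by ring; rewrite <- E.
        replace (w + (y - w))%C with y by ring; exact Hy. }
      rewrite (psum_ddc_below Rad a y w Ha (Hg y Hy) (proj1 (Hl w (or_introl eq_refl)))).
      unfold Lprod; simpl; field; exact N. }
    unfold residue_integral; rewrite E, cycle_integral_lin.
    + rewrite (psum_cycle_integral Rad) by (trivial; apply ddc_bound_below; trivial;
        apply (Hl w (or_introl eq_refl))).
      pose proof (residue_integral_inv_Lprod gamma 0 (w :: k) eq_refl
        (fun u Hu => proj2 (Hl u Hu))) as E1; unfold residue_integral in E1.
      rewrite Cplus_0_l, (Cmult_comm (psum a w)), Cmult_assoc, E1; simpl; ring.
    + intros u Hu; apply (psum_cont_below Rad); auto.
      apply ddc_bound_below; trivial; apply (Hl w (or_introl eq_refl)).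
    + intros u Hu; apply Lprod_inv_cont; intros Hin; exact (proj1 (proj2 (Hl u Hin)) Hu).
  - assert (Hw := Hl w (or_introl eq_refl)).
    assert (Hb : coef_bound_below Rad (ddc a w)) by (apply ddc_bound_below; tauto).
    assert (Hl' : forall u, In u (v :: l) -> Cmod u < Rad /\ ~ in_trace gamma u /\ winding gamma u = 1%C)
      by (intros u Hu; apply Hl; now right).
    simpl divided_difference; rewrite <- (IH v (ddc a w) Hb Hl').
    assert (E : cycle_integral (fun y => psum a y * / Lprod (w :: v :: l) y)%C gamma =
      cycle_integral (fun y => psum (ddc a w) y * / Lprod (v :: l) y +
        psum a w * / Lprod (w :: v :: l) y)%C gamma).
    { apply cycle_integral_ext; intros y Hy.
      assert (N : (y - w)%C <> 0%C).
      { intros E; apply (proj1 (proj2 Hw)).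
        replace w with (w + 0)%C by ring; rewrite <- E.
        replace (w + (y - w))%C with y by ring; exact Hy. }
      assert (N1 : Lprod (v :: l) y <> 0%C).
      { apply Lprod_neq_0; intros Hin; exact (proj1 (proj2 (Hl' y Hin)) Hy). }
      rewrite (psum_ddc_below Rad a y w Ha (Hg y Hy) (proj1 Hw)).
      change (Lprod (w :: v :: l) y) with ((y - w) * Lprod (v :: l) y)%C.
      field; split; assumption. }
    unfold residue_integral; rewrite E, cycle_integral_lin.
    + pose proof (residue_integral_inv_Lprod gamma (S (length l)) (w :: v :: l) eq_refl
        (fun u Hu => proj2 (Hl u Hu))) as E1; unfold residue_integral in E1.
      match type of E1 with (?c * ?X)%C = _ =>
        match goal with |- (_ * (?Y + ?p * _))%C = _ =>
          replace (c * (Y + p * X))%C with (c * Y + p * (c * X))%C by ring end end.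
      rewrite E1; ring.
    + intros u Hu; apply C_cont_mult; [apply (psum_cont_below Rad); auto|].
      apply Lprod_inv_cont; intros Hin; exact (proj1 (proj2 (Hl' u Hin)) Hu).
    + intros u Hu; apply Lprod_inv_cont; intros Hin; exact (proj1 (proj2 (Hl u Hin)) Hu).
Qed.

(** Coefficients of the divided difference with nodes [u 0, ..., u (n - 1)] fixed and the last
    argument free: at [u n] it gives a Newton coefficient, at [x] the factor in the remainder. *)
Fixpoint dds (a : nat -> C) (u : nat -> C) (n : nat) : nat -> C :=
  match n with O => a | S m => ddc (dds a u m) (u m) end.

Lemma divided_difference_dds a u k : forall m,
  divided_difference (dds a u m) (u m) (map u (seq (S m) k)) =
  psum (dds a u (m + k)%nat) (u (m + k)%nat).
Proof.
  induction k as [|k IH]; intros m; simpl; [now rewrite Nat.add_0_r|].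
  rewrite <- Nat.add_succ_comm; apply (IH (S m)).
Qed.

Lemma Cprod_Lprod (u : nat -> C) (y : C) (n : nat) :
  Cprod (fun j => y - u j)%C n = Lprod (map u (seq 0 n)) y.
Proof.
  induction n as [|n IH]; [reflexivity|].
  rewrite seq_S, map_app, Lprod_app, <- IH; unfold Lprod; simpl; ring.
Qed.

Lemma Cprod_ext (F G : nat -> C) (n : nat) :
  (forall j, (j < n)%nat -> F j = G j) -> Cprod F n = Cprod G n.
Proof.
  induction n as [|n IH]; intros H; [reflexivity|]; simpl.
  rewrite IH, H by (intros; try apply H; lia); reflexivity.
Qed.

(** Serves the case of a [P]-sequence that runs through the nodes backwards. *)
Lemma Cprod_rev (F : nat -> C) (n : nat) :
  Cprod (fun j => F (n - j)%nat) (S n) = Cprod F (S n).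
Proof.
  assert (Hfirst : forall (G : nat -> C) m, Cprod G (S m) = (G O * Cprod (fun j => G (S j)) m)%C).
  { intros G m; induction m as [|m IH]; [simpl; ring|].
    change (Cprod G (S (S m))) with (Cprod G (S m) * G (S m))%C; rewrite IH; simpl; ring. }
  induction n as [|n IH]; [reflexivity|].
  rewrite Hfirst, Nat.sub_0_r.
  rewrite (Cprod_ext _ (fun j => F (n - j)%nat) (S n)) by (intros; f_equal; lia).
  rewrite IH; change (Cprod F (S (S n))) with (Cprod F (S n) * F (S n))%C; ring.
Qed.

(** The last divided difference at [x] is split at the next node: its value there is the new Newton
    coefficient. The bound is carried along because this split requires it. *)
Lemma newton_remainder Rad a u x n :
  coef_bound_below Rad a -> (forall j, Cmod (u j) < Rad) -> Cmod x < Rad ->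
  coef_bound_below Rad (dds a u (S n)) /\
  psum a x = (sum_n (G := C_AbelianMonoid)
     (fun k => psum (dds a u k) (u k) * Cprod (fun j => x - u j) k)%C n +
   psum (dds a u (S n)) x * Cprod (fun j => x - u j) (S n))%C.
Proof.
  intros Ha Hu Hx; induction n as [|n [IH1 IH2]].
  - split; [apply ddc_bound_below; auto|].
    rewrite sum_O, (psum_ddc_below Rad a x (u O) Ha Hx (Hu O)); simpl; ring.
  - split; [apply ddc_bound_below; auto|].
    rewrite sum_Sn, IH2.
    set (A := sum_n _ n).
    rewrite (psum_ddc_below Rad (dds a u (S n)) x (u (S n)) IH1 Hx (Hu (S n))).
    change (dds a u (S (S n))) with (ddc (dds a u (S n)) (u (S n))).
    change (Cprod (fun j => x - u j)%C (S (S n))) with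
      (Cprod (fun j => x - u j) (S n) * (x - u (S n)))%C.
    change (plus A (psum (dds a u (S n)) (u (S n)) * Cprod (fun j => x - u j) (S n))%C)
      with (A + psum (dds a u (S n)) (u (S n)) * Cprod (fun j => x - u j) (S n))%C.
    generalize (Cprod (fun j => x - u j)%C (S n)); intros Q; ring.
Qed.

(** * Convergence of the Taylor polynomials *)

Lemma quadratic_roots (p q p' q' : C) :
  (forall y, ((y - p) * (y - q))%C = ((y - p') * (y - q'))%C) ->
  (p = p' /\ q = q') \/ (p = q' /\ q = p').
Proof.
  intros H.
  assert (Hsum : (p + q)%C = (p' + q')%C).
  { pose proof (H 0%C) as H0; pose proof (H 1%C) as H1.
    replace (p + q)%C with ((0 - p) * (0 - q) + 1 - (1 - p) * (1 - q))%C by ring.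
    rewrite H0, H1; ring. }
  assert (Hp : ((p - p') * (p - q'))%C = 0%C) by (rewrite <- H; ring).
  destruct (Ceq_dec p p') as [E|E].
  - left; split; [exact E|].
    replace q with (p + q - p)%C by ring; rewrite Hsum, E; ring.
  - right.
    assert (E' : p = q').
    { replace p with (/ (p - p') * ((p - p') * (p - q')) + q')%C.
      - rewrite Hp; ring.
      - field; intros E0; apply E; replace p with (p - p' + p')%C by ring; rewrite E0; ring. }
    split; [exact E'|].
    replace q with (p + q - p)%C by ring; rewrite Hsum, E'; ring.
Qed.

Lemma P_sequence_shift P z k : P_sequence P z -> P_sequence P (fun m => z (k + m)%Z).
Proof.
  intros H m y; rewrite (H (k + m)%Z y).
  now replace (k + m + 1)%Z with (k + (m + 1))%Z by lia;
    replace (k + m - 1)%Z with (k + (m - 1))%Z by lia.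
Qed.

Lemma P_sequence_opp P z : P_sequence P z -> P_sequence P (fun m => z (- m)%Z).
Proof.
  intros H m y; rewrite (H (- m)%Z y).
  replace (- m + 1)%Z with (- (m - 1))%Z by lia;
    replace (- m - 1)%Z with (- (m + 1))%Z by lia; ring.
Qed.

(** [P (x m)] has the two neighbours of [x m] as roots, so one neighbour determines the other and
    the values spread upwards from two consecutive terms. The negative indices follow by
    reflection. *)
Lemma P_sequence_eq P x z :
  P_sequence P x -> P_sequence P z ->
  x 0%Z = z 0%Z -> x 1%Z = z 1%Z -> x (-1)%Z = z (-1)%Z -> forall m, x m = z m.
Proof.
  assert (Hpos : forall x z, P_sequence P x -> P_sequence P z ->
    x 0%Z = z 0%Z -> x 1%Z = z 1%Z ->
    forall n, x (Z.of_nat n) = z (Z.of_nat n) /\ x (Z.of_nat (S n)) = z (Z.of_nat (S n))).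
  { clear; intros x z Hx Hz E0 E1; induction n as [|n [IH1 IH2]]; [split; assumption|].
    split; [exact IH2|].
    set (c := z (Z.of_nat n)) in *.
    (* At [y = c + 1] the factor of the known neighbour [c] equals 1, which isolates the unknown
       one. *)
    pose proof (Hx (Z.of_nat (S n)) (c + 1)%C) as H1.
    pose proof (Hz (Z.of_nat (S n)) (c + 1)%C) as H2.
    rewrite IH2, H2 in H1.
    replace (Z.of_nat (S n) + 1)%Z with (Z.of_nat (S (S n))) in H1 by lia.
    replace (Z.of_nat (S n) - 1)%Z with (Z.of_nat n) in H1 by lia.
    rewrite IH1 in H1; fold c in H1.
    replace (c + 1 - c)%C with (1 : C) in H1 by ring; rewrite !Cmult_1_r in H1.
    replace (x (Z.of_nat (S (S n)))) with (c + 1 - (c + 1 - x (Z.of_nat (S (S n)))))%C by ring.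
    rewrite <- H1; ring. }
  intros Hx Hz E0 E1 Em m.
  destruct (Z_le_gt_dec 0 m) as [Hm|Hm].
  - rewrite <- (Z2Nat.id m Hm); now apply Hpos.
  - replace m with (- Z.of_nat (Z.to_nat (- m)))%Z by lia.
    apply (Hpos _ _ (P_sequence_opp _ _ Hx) (P_sequence_opp _ _ Hz)); assumption.
Qed.

(** The neighbours of the base point are the roots of one quadratic, hence coincide in order or
    swapped; the swapped case is the reflected sequence. *)
Lemma P_sequence_same_base P x z k :
  P_sequence P x -> P_sequence P z -> x 0%Z = z k ->
  (forall m, x m = z (k + m)%Z) \/ (forall m, x m = z (k - m)%Z).
Proof.
  intros Hx Hz E.
  pose proof (P_sequence_shift P z k Hz) as Hzk.
  destruct (quadratic_roots (x 1%Z) (x (-1)%Z) (z (k + 1)%Z) (z (k - 1)%Z)) as [[E1 E2]|[E1 E2]].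
  - intros y; rewrite <- (Hz k y), <- E; symmetry; exact (Hx 0%Z y).
  - left; apply (P_sequence_eq P x (fun m => z (k + m)%Z) Hx Hzk);
      [now rewrite Z.add_0_r|exact E1|exact E2].
  - right; intros m.
    apply (P_sequence_eq P x (fun m => z (k + - m)%Z) Hx (P_sequence_opp _ _ Hzk));
      [now rewrite Z.add_0_r|exact E1|exact E2].
Qed.

(** Centred at [z_{k/2}], the encoded index [2 j - k] becomes [2 j], or [2 (k - j)] for the
    reflected sequence. In both cases the nodes are [z_0, ..., z_k], possibly in reverse order. *)
Lemma Phi_nodes P x z k y :
  P_sequence P x -> P_sequence P z -> x 0%Z = z (Z.of_nat k) ->
  Phi x (k + 1) y = Lprod (map (int_term z) (seq 0 (S k))) y /\
  forall j, (j <= k)%nat -> exists i, (i <= k)%nat /\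
    x (2 * Z.of_nat i - Z.of_nat k)%Z = int_term z j.
Proof.
  intros Hx Hz E; rewrite <- Cprod_Lprod; unfold Phi, int_term.
  rewrite Nat.add_1_r.
  destruct (P_sequence_same_base P x z (Z.of_nat k) Hx Hz E) as [H|H]; split.
  - apply Cprod_ext; intros j _; rewrite H; do 2 f_equal; lia.
  - intros j Hj; exists j; split; [exact Hj|]; rewrite H; f_equal; lia.
  - rewrite <- (Cprod_rev (fun j => (y - z (2 * Z.of_nat j)%Z)%C)).
    apply Cprod_ext; intros j Hj; rewrite H; do 2 f_equal; lia.
  - intros j Hj; exists (k - j)%nat; split; [lia|]; rewrite H; f_equal; lia.
Qed.

Lemma in_map_seq (u : nat -> C) (k : nat) (v : C) :
  In v (map u (seq 0 (S k))) -> exists j, (j <= k)%nat /\ v = u j.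
Proof.
  intros H; apply in_map_iff in H; destruct H as (j & <- & Hj).
  apply in_seq in Hj; exists j; split; [lia|reflexivity].
Qed.

Lemma nodes_integral Rad a f gamma u k :
  coef_bound_below Rad a -> (forall w, Cmod w < Rad -> f w = psum a w) ->
  (forall w, in_trace gamma w -> Cmod w < Rad) ->
  (forall j, (j <= k)%nat ->
    Cmod (u j) < Rad /\ ~ in_trace gamma (u j) /\ winding gamma (u j) = 1%C) ->
  residue_integral gamma (fun y => f y / Lprod (map u (seq 0 (S k))) y)%C =
  psum (dds a u k) (u k).
Proof.
  intros Ha Hf Hg Hu.
  pose proof (divided_difference_dds a u k 0) as E.
  change (0 + k)%nat with k in E; change (dds a u 0) with a in E; rewrite <- E.
  rewrite <- (residue_integral_divided_difference Rad gamma Hg _ _ a Ha).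
  - unfold residue_integral; f_equal; apply cycle_integral_ext; intros w Hw.
    rewrite (Hf w (Hg w Hw)); reflexivity.
  - intros v Hv; change (u 0%nat :: map u (seq 1 k)) with (map u (seq 0 (S k))) in Hv.
    destruct (in_map_seq u k v Hv) as (j & Hj & ->); now apply Hu.
Qed.

Lemma pdiff_value P z Rad a f rho k :
  P_sequence P z -> coef_bound_below Rad a ->
  (forall w, Cmod w < Rad -> f w = psum a w) ->
  0 < rho < Rad -> (forall j, Cmod (int_term z j) < rho) ->
  pdiff P (disk Rad) f k (z (Z.of_nat k)) = psum (dds a (int_term z) k) (int_term z k).
Proof.
  intros Hz Ha Hf Hr Hu.
  set (v := psum _ _).
  assert (Huniq : forall v', is_pdiff P (disk Rad) f k (z (Z.of_nat k)) v' -> v' = v).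
  { intros v' (x & gamma & Hx & Hx0 & [Hg _] & Hnodes & ->).
    unfold v; rewrite <- (nodes_integral Rad a f gamma (int_term z) k Ha Hf Hg).
    - unfold residue_integral; f_equal; apply cycle_integral_ext; intros w _.
      now rewrite (proj1 (Phi_nodes P x z k w Hx Hz Hx0)).
    - intros j Hj; destruct (proj2 (Phi_nodes P x z k 0%C Hx Hz Hx0) j Hj) as (i & Hi & <-).
      exact (Hnodes i Hi). }
  assert (Hex : is_pdiff P (disk Rad) f k (z (Z.of_nat k)) v).
  { assert (Htr : forall w, in_trace (circle rho) w -> Cmod w = rho)
      by (intros w; apply in_trace_circle; lra).
    assert (Hz' := P_sequence_shift P z (Z.of_nat k) Hz).
    assert (Hz0 : z (Z.of_nat k + 0)%Z = z (Z.of_nat k)) by now rewrite Z.add_0_r.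
    assert (Hnode : forall j, ~ in_trace (circle rho) (int_term z j) /\
      winding (circle rho) (int_term z j) = 1%C).
    { intros j; split; [|now apply winding_circle_inside].
      intros Hin; apply Htr in Hin; specialize (Hu j); lra. }
    assert (Hdisk : forall j, Cmod (int_term z j) < Rad)
      by (intros j; specialize (Hu j); lra).
    exists (fun m => z (Z.of_nat k + m)%Z), (circle rho).
    split; [exact Hz'|]; split; [exact Hz0|]; split; [split|split].
    - intros w Hw; unfold disk; rewrite (Htr w Hw); lra.
    - intros w Hw; apply winding_circle_outside; unfold disk in Hw; lra.
    - intros j Hj node.
      assert (En : node = int_term z j) by (unfold node, int_term; f_equal; lia).
      rewrite En; split; [apply Hdisk|apply Hnode].
    - unfold v; rewrite <- (nodes_integral Rad a f (circle rho) (int_term z) k Ha Hf).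
      + unfold residue_integral; f_equal; apply cycle_integral_ext; intros w _.
        now rewrite (proj1 (Phi_nodes P _ z k w Hz' Hz Hz0)).
      + intros w Hw; rewrite (Htr w Hw); lra.
      + intros j _; split; [apply Hdisk|apply Hnode]. }
  apply Huniq.
  refine (iota_correct (V := C_R_CompleteNormedModule)
    (is_pdiff P (disk Rad) f k (z (Z.of_nat k))) _).
  exists v; split; [exact Hex|]; intros v' Hv'; symmetry; now apply Huniq.
Qed.

(** * Geometric decay of the remainder *)

Fixpoint Rprod (F : nat -> R) (n : nat) : R :=
  match n with O => 1 | S m => Rprod F m * F m end.

Lemma Rprod_pos F n : (forall j, 0 < F j) -> 0 < Rprod F n.
Proof.
  intros H; induction n as [|n IH]; simpl; [lra|]; now apply Rmult_lt_0_compat.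
Qed.

Lemma Cmod_Cprod_le u x rx n :
  Cmod x <= rx ->
  Cmod (Cprod (fun j => x - u j)%C n) <= Rprod (fun j => rx + Cmod (u j)) n.
Proof.
  intros Hx; induction n as [|n IH]; simpl; [rewrite Cmod_1; lra|].
  rewrite Cmod_mult; apply Rmult_le_compat; try apply Cmod_ge_0; [exact IH|].
  eapply Rle_trans; [apply Cmod_triangle|]; rewrite Cmod_opp; lra.
Qed.

Lemma dds_coef_bound a u rho M n :
  coef_bound a rho M -> (forall j, Cmod (u j) < rho) ->
  coef_bound (dds a u n) rho (M * Rprod (fun j => / (rho - Cmod (u j))) n).
Proof.
  intros Ha Hu; induction n as [|n IH]; simpl; [now rewrite Rmult_1_r|].
  rewrite <- Rmult_assoc; now apply ddc_bound.
Qed.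

(** The first [N] factors, which may be large, go into the constant [K]. *)
Lemma Rprod_ratio_le F G q N :
  (forall j, 0 <= F j * G j) -> (forall j, (N <= j)%nat -> F j * G j <= q) ->
  exists K, 0 <= K /\ forall n, Rprod F (N + n) * Rprod G (N + n) <= K * q ^ n.
Proof.
  intros Hpos Hq.
  assert (HP : forall n, 0 <= Rprod F n * Rprod G n).
  { induction n as [|n IH]; simpl; [lra|].
    replace (Rprod F n * F n * (Rprod G n * G n))
      with (Rprod F n * Rprod G n * (F n * G n)) by ring.
    now apply Rmult_le_pos. }
  exists (Rprod F N * Rprod G N); split; [apply HP|].
  induction n as [|n IH]; [rewrite Nat.add_0_r; simpl; lra|].
  rewrite Nat.add_succ_r; simpl.
  replace (Rprod F (N + n) * F (N + n)%nat * (Rprod G (N + n) * G (N + n)%nat))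
    with (Rprod F (N + n) * Rprod G (N + n) * (F (N + n)%nat * G (N + n)%nat)) by ring.
  replace (Rprod F N * Rprod G N * (q * q ^ n))
    with (Rprod F N * Rprod G N * q ^ n * q) by ring.
  apply Rmult_le_compat; [apply HP|apply Hpos|exact IH|apply Hq; lia].
Qed.

Lemma finite_bound_lt (g : nat -> R) (b : R) (N : nat) :
  (forall j, g j < b) -> exists m, m < b /\ forall j, (j < N)%nat -> g j <= m.
Proof.
  intros H; induction N as [|N (m & Hm & IH)].
  - exists (b - 1); split; [lra|]; intros j Hj; lia.
  - exists (Rmax m (g N)); split; [now apply Rmax_lub_lt|]; intros j Hj.
    destruct (Nat.eq_dec j N) as [->|Hn]; [apply Rmax_r|].
    eapply Rle_trans; [apply IH; lia|apply Rmax_l].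
Qed.

Theorem theorem2p6 :
  forall (P : C -> C -> C) (z : Z -> C),
    in_calP P ->
    P_sequence P z ->
    (exists M : R, forall j : nat, Cmod (int_term z j) <= M) ->
  forall zbar : R,
    is_LimSup_seq (fun j : nat => Cmod (int_term z j)) (Finite zbar) ->
  forall (r delta : R) (f : C -> C),
    2 * zbar < r ->
    0 < delta ->
    analytic_on (disk (r + delta)) f ->
    (forall j : nat, disk (r + delta) (int_term z j)) ->
  forall rx : R,
    0 < rx < r - 2 * zbar ->
    forall eps : R, 0 < eps ->
      exists N : nat, forall n : nat, (N <= n)%nat ->
        forall x : C, disk rx x ->
          Cmod (taylor_poly P (disk (r + delta)) z f n x - f x)%C < eps.
Proof.
  intros P z _ Hz _ zbar Hsup r delta f Hr Hdelta Hf Hdisk rx Hrx eps Heps.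
  set (u := int_term z) in *.
  set (Rad := r + delta) in *.
  (* A quarter of the gap: replacing [zbar] by [zbar + e] on both sides of [rx + zbar < r - zbar]
     uses up only half of it. *)
  set (e := (r - 2 * zbar - rx) / 4).
  assert (He : 0 < e) by (unfold e; lra).
  destruct (proj2 (Hsup (mkposreal e He))) as [N HN]; simpl in HN.
  set (zeta := zbar + e) in *.
  assert (Hzeta : 0 < zeta).
  { pose proof (HN N (Nat.le_refl N)); pose proof (Cmod_ge_0 (u N)); lra. }
  assert (Hrz : rx + zeta < r - zeta) by (unfold zeta, e; lra).
  destruct (finite_bound_lt (fun j => Cmod (u j)) Rad N Hdisk) as (m & Hm & Hmj).
  (* The first [N] nodes have modulus at most [m], the later ones less than [zeta < r]; the midpoint
     thus exceeds every node and [r], and stays below [Rad]. *)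
  set (rho := (Rmax m r + Rad) / 2).
  assert (Hmr : Rmax m r < Rad) by (apply Rmax_lub_lt; [exact Hm|unfold Rad; lra]).
  pose proof (Rmax_l m r) as Hml; pose proof (Rmax_r m r) as Hmr'.
  assert (Hrho : r < rho < Rad) by (unfold rho; lra).
  assert (Hu : forall j, Cmod (u j) < rho).
  { intros j; destruct (Nat.lt_ge_cases j N) as [Hj|Hj].
    - specialize (Hmj j Hj); unfold rho; lra.
    - specialize (HN j Hj); fold zeta in HN; lra. }
  destruct (analytic_disk_psum Rad f ltac:(lra) Hf) as (a & Ha & Hfa).
  destruct (Ha rho ltac:(lra)) as [M HM].
  pose proof (coef_bound_pos _ _ _ HM) as HM0.
  (* For [j >= N] the factor [(rx + |u j|) / (rho - |u j|)] increases when [|u j|] is replaced by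
     [zeta] and [rho] by [r]. *)
  set (q := (rx + zeta) / (r - zeta)).
  assert (Hq : 0 <= q < 1).
  { split; [apply Rdiv_le_0_compat; lra|].
    apply Rmult_lt_reg_r with (r - zeta); [lra|]; unfold q; field_simplify; lra. }
  set (F := fun j => / (rho - Cmod (u j))).
  set (G := fun j => rx + Cmod (u j)).
  assert (HF : forall j, 0 < F j) by (intros j; specialize (Hu j); apply Rinv_0_lt_compat; lra).
  assert (HG : forall j, 0 < G j) by (intros j; pose proof (Cmod_ge_0 (u j)); unfold G; lra).
  destruct (Rprod_ratio_le F G q N) as (K & HK & HFG).
  { intros j; left; now apply Rmult_lt_0_compat. }
  { intros j Hj; specialize (HN j Hj); unfold q, Rdiv; rewrite Rmult_comm.
    apply Rmult_le_compat; [left; apply HG|left; apply HF|unfold G; lra|].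
    apply Rinv_le_contravar; lra. }
  (* [M * rho / (rho - rx)] comes from bounding the remainder series uniformly for [|x| < rx], [K]
     from the first [N] nodes. As [c] may be 0, [eps] is divided by [c + 1] below. *)
  set (c := M * rho / (rho - rx) * K).
  assert (Hc : 0 <= c).
  { apply Rmult_le_pos; [|exact HK]; apply Rdiv_le_0_compat; [nra|lra]. }
  destruct (pow_lt_1_zero q ltac:(rewrite Rabs_pos_eq; lra) (eps / (c + 1))) as [N1 HN1].
  { apply Rdiv_lt_0_compat; lra. }
  exists (N + N1)%nat; intros n Hn x Hx; unfold disk in Hx.
  assert (HaR : coef_bound_below Rad a) by exact Ha.
  destruct (newton_remainder Rad a u x n HaR Hdisk ltac:(lra)) as [_ Enewton].
  rewrite <- Hfa in Enewton by lra.
  assert (ET : taylor_poly P (disk Rad) z f n x = sum_n (G := C_AbelianMonoid)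
     (fun k => psum (dds a u k) (u k) * Cprod (fun j => x - u j) k)%C n).
  { unfold taylor_poly; apply (sum_n_ext (G := C_AbelianMonoid)); intros k.
    now rewrite (pdiff_value P z Rad a f rho k Hz HaR Hfa ltac:(lra) Hu). }
  rewrite ET, Enewton.
  set (A := sum_n _ n).
  match goal with |- Cmod (A - (A + ?B))%C < _ =>
    replace (A - (A + B))%C with (- B)%C by ring end.
  rewrite Cmod_opp, Cmod_mult.
  pose proof (dds_coef_bound a u rho M (S n) HM Hu) as Hb; fold F in Hb.
  pose proof (psum_bound _ _ _ x Hb ltac:(lra)) as H1.
  pose proof (Cmod_Cprod_le u x rx (S n) ltac:(lra)) as H2; fold G in H2.
  assert (H3 : M * Rprod F (S n) * rho / (rho - Cmod x) <= M * Rprod F (S n) * rho / (rho - rx)).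
  { apply Rmult_le_compat_l; [|apply Rinv_le_contravar; lra].
    pose proof (Rprod_pos F (S n) HF); apply Rmult_le_pos; [|lra].
    apply Rmult_le_pos; lra. }
  (* The remainder after [S_n] carries [n + 1] factors, [N] of which are absorbed in [K];
     [n >= N + N1] leaves at least [N1] factors bounded by [q]. *)
  set (k := (S n - N)%nat).
  assert (Hk : S n = (N + k)%nat) by (unfold k; lia).
  apply Rle_lt_trans with (M * rho / (rho - rx) * (Rprod F (S n) * Rprod G (S n))).
  { apply Rle_trans with (M * Rprod F (S n) * rho / (rho - rx) * Rprod G (S n)).
    - apply Rmult_le_compat; try apply Cmod_ge_0; lra.
    - right; field; lra. }
  apply Rle_lt_trans with (c * q ^ k).
  { unfold c; rewrite Rmult_assoc; apply Rmult_le_compat_l.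
    - apply Rdiv_le_0_compat; [nra|lra].
    - rewrite Hk; apply HFG. }
  specialize (HN1 k ltac:(unfold k; lia)).
  rewrite Rabs_pos_eq in HN1 by (apply pow_le; lra).
  apply Rmult_lt_compat_l with (r := c + 1) in HN1; [|lra].
  replace ((c + 1) * (eps / (c + 1))) with eps in HN1 by (field; lra).
  assert (0 <= q ^ k) by (apply pow_le; lra).
  lra.
Qed.
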